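(* There is a polynomial-time algorithm (polynomial in $mn$) which, given any two locally-valid MV assignments $\mu_1$ and $\mu_2$ of the $m\times n$ Miura-ori crease pattern, finds a minimum-length sequence of face flips that converts $\mu_1$ to $\mu_2$.
   Context: Miura-ori: a crease pattern formed by equally spaced parallel lines crossed by zigzag paths which divide the paper into congruent (non-rectangular) parallelograms; parallelograms are reflected across the parallel lines and translated in the direction of the parallel lines. The $m\times n$ Miura-ori ($m,n\ge 2$) has faces (parallelograms) indexed by $(i,j)$, $1\le i\le m$, $1\le j\le n$, where row $i$ is a strip between two consecutive parallel lines and faces $(i,j),(i,j+1)$ share a segment of a zigzag path, while $(i,j),(i+1,j)$ share a segment of a parallel line. Creases are the segments shared by two faces. Each interior vertex has degree 4: two of its creases, $a$ and $b$, belong to a zigzag path and two, $p$ and $q$, lie on a parallel line; $a$ and $b$ both make the same acute angle with one of the parallel-line creases, say $q$, and the same obtuse angle with the other, $p$. A mountain-valley (MV) assignment is a function $\mu$ from the creases to $\{-1,1\}$ ($1$ = mountain, $-1$ = valley). It is locally valid if at each interior vertex (with the notation above) three of the four creases have one type and the remaining one has the other type, and moreover if $\mu(a)=\mu(b)$ then the third crease of that same type is $p$ (the crease farthest by angle from $a$ and $b$). Flipping a face $F$ under $\mu$ produces $\mu_F$ with $\mu_F(e)=-\mu(e)$ for every crease $e$ bordering $F$ and $\mu_F(e)=\mu(e)$ otherwise. A sequence of face flips converting $\mu_1$ to $\mu_2$ is a sequence of single face flips starting at $\mu_1$ and ending at $\mu_2$ with all intermediate MV assignments locally valid; its length is the number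 of flips. *)

(* Defs.v *)
From mathcomp Require Import all_boot all_order all_algebra ring.

Set Implicit Arguments.
Unset Strict Implicit.
Unset Printing Implicit Defensive.

Import Order.TTheory GRing.Theory Num.Theory.

(** * The Miura-ori *)

(* Faces are numbered from 0.  Row i is the strip between the parallel lines
   number i and i.+1. *)
Definition face (m n : nat) : finType := ('I_m * 'I_n)%type.

(* inl (i, j) is the parallel-line segment shared by faces (i, j), (i.+1, j);
   inr (i, j) is the zigzag segment shared by faces (i, j), (i, j.+1). *)
Definition crease (m n : nat) : finType :=
  ('I_m.-1 * 'I_n + 'I_m * 'I_n.-1)%type.

(* The pair (r, c) names the point where parallel line number r meets zigzag
   path number c (0 <= r <= m, 0 <= c <= n); lines 0 and m and paths 0 and n
   form the boundary of the paper. *)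
Definition vertex : Type := (nat * nat)%type.

Definition interior (m n : nat) (v : vertex) : bool :=
  (0 < v.1 < m) && (0 < v.2 < n).

Definition corners m n (F : face m n) : seq vertex :=
  let: (i, j) := F in
  [:: (nat_of_ord i, nat_of_ord j); (nat_of_ord i, j.+1);
      (i.+1, nat_of_ord j); (i.+1, j.+1)].

Definition ends m n (e : crease m n) : vertex * vertex :=
  match e with
  | inl (i, j) => ((i.+1, nat_of_ord j), (i.+1, j.+1))
  | inr (i, j) => ((nat_of_ord i, j.+1), (i.+1, j.+1))
  end.

Definition on_zigzag m n (e : crease m n) : bool :=
  if e is inr _ then true else false.

Definition borders m n (e : crease m n) (F : face m n) : bool :=
  ((ends e).1 \in corners F) && ((ends e).2 \in corners F).

Definition at_vertex m n (v : vertex) (e : crease m n) : bool :=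
  (v == (ends e).1) || (v == (ends e).2).

Definition other_end m n (v : vertex) (e : crease m n) : vertex :=
  if v == (ends e).1 then (ends e).2 else (ends e).1.

Section Geometry.
Local Open Scope ring_scope.
Variables (R : realFieldType) (w h s : R).

(* The parallel lines are h apart and the paths are translates of each other
   by w; each path zigzags horizontally by s, so that consecutive rows are
   mirror images in the line between them.  The parallelograms are
   non-rectangular iff s != 0, and the sign of s is the direction of the first
   bend. *)
Definition pos (v : vertex) : R * R :=
  (v.2%:R * w + (if odd v.1 then s else 0), v.1%:R * h).

Definition dir m n (v : vertex) (e : crease m n) : R * R :=
  pos (other_end v e) - pos v.

Definition dot (x y : R * R) : R := x.1 * y.1 + x.2 * y.2.

Definition acute m n (v : vertex) (e f : crease m n) : bool :=
  0 < dot (dir v e) (dir v f).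

Definition obtuse m n (v : vertex) (e f : crease m n) : bool :=
  dot (dir v e) (dir v f) < 0.

Definition roles m n (v : vertex) (a b p q : crease m n) : bool :=
  [&& all (at_vertex v) [:: a; b; p; q],
      on_zigzag a, on_zigzag b, a != b,
      ~~ on_zigzag p, ~~ on_zigzag q,
      acute v a q, acute v b q, obtuse v a p & obtuse v b p].

(* true is mountain (1), false is valley (-1). *)
Definition mv (m n : nat) : finType := {ffun crease m n -> bool}.

Definition locally_valid m n (mu : mv m n) : Prop :=
  forall v : vertex, interior m n v ->
  forall a b p q : crease m n, roles v a b p q ->
    (mu a + mu b + mu p + mu q \in [:: 1; 3])%N /\
    (mu a = mu b -> mu p = mu a).

Definition flip m n (F : face m n) (mu : mv m n) : mv m n :=
  [ffun e => if borders e F then ~~ mu e else mu e].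

Definition flips m n (mu : mv m n) (sq : seq (face m n)) : mv m n :=
  foldl (fun nu F => flip F nu) mu sq.

Definition flip_sequence m n (mu1 mu2 : mv m n) (sq : seq (face m n)) : Prop :=
  (forall k, (k <= size sq)%N -> locally_valid (flips mu1 (take k sq))) /\
  flips mu1 sq = mu2.

Definition shortest_flip_sequence m n (mu1 mu2 : mv m n)
    (sq : seq (face m n)) : Prop :=
  flip_sequence mu1 mu2 sq /\
  forall sq', flip_sequence mu1 mu2 sq' -> (size sq <= size sq')%N.

(* The definition of local validity is not vacuous. *)
Lemma roles_exist m n (v : vertex) : 0 < w -> s != 0 -> interior m n v ->
  exists a b p q : crease m n, roles v a b p q.
Proof.
case: v => -[|r] [|c] w0 s0; rewrite /interior /= ?andbF //.
case/andP=> hr hc.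
have hr' : (r < m.-1)%N by rewrite ltn_predRL.
have hc' : (c < n.-1)%N by rewrite ltn_predRL.
pose a : crease m n := inr (Ordinal (ltnW hr), Ordinal hc').
pose b : crease m n := inr (Ordinal hr, Ordinal hc').
pose l : crease m n := inl (Ordinal hr', Ordinal (ltnW hc)).
pose t : crease m n := inl (Ordinal hr', Ordinal hc).
pose d : R := if odd r then s else - s.
have nS k : ((k.+1 == k) = false)%N by rewrite gtn_eqF.
have d0 : d != 0 by rewrite /d; case: (odd r); rewrite ?oppr_eq0.
have dirE :
  [/\ (dir (r.+1, c.+1) a).1 = d, (dir (r.+1, c.+1) b).1 = d,
      dir (r.+1, c.+1) l = (- w, 0) & dir (r.+1, c.+1) t = (w, 0)].
  rewrite /dir /other_end /= !xpair_eqE !nS !eqxx /= ?andbF /= /d.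
  split; rewrite /pos /=; try congr pair => /=; case: (odd r) => /=; ring.
have [da db dl dt] := dirE.
have ab : a != b by rewrite /a /b (inj_eq inr_inj) xpair_eqE -val_eqE /= eq_sym nS.
case/lt_total/orP: d0 => d_sg; [exists a, b, t, l | exists a, b, l, t];
  rewrite /roles /acute /obtuse /dot dl dt da db ab /at_vertex /=
    !xpair_eqE !eqxx /= ?orbT !mulr0 !addr0 ?mulrN ?oppr_gt0 ?oppr_lt0;
  by rewrite ?(pmulr_llt0 _ w0) ?(pmulr_lgt0 _ w0) d_sg.
Qed.
End Geometry.

(** * Random access machines *)

(* Programs act on registers and on an array of cells (the heap), both indexed
   by nat and holding natural numbers.  Multiplication is deliberately
   absent: with addition and truncated subtraction only, t steps lengthen the
   numbers by O(t) bits, so that polynomial time for the unit-cost measure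
   below coincides with polynomial time on Turing machines. *)
Inductive expr : Type :=
| Cst of nat
| Reg of nat
| Cell of expr
| Add of expr & expr
| Sub of expr & expr.

Inductive cmd : Type :=
| Skip
| Set_reg of nat & expr
| Store of expr & expr
| Seq of cmd & cmd
| If of expr & cmd & cmd
| While of expr & cmd.

Record state : Type := State { regs : nat -> nat; heap : nat -> nat }.

Definition upd (f : nat -> nat) (x v : nat) : nat -> nat :=
  fun y => if y == x then v else f y.

Fixpoint eval (st : state) (e : expr) : nat :=
  match e with
  | Cst k => k
  | Reg x => regs st x
  | Cell e1 => heap st (eval st e1)
  | Add e1 e2 => eval st e1 + eval st e2
  | Sub e1 e2 => eval st e1 - eval st e2
  end.

Fixpoint cost (e : expr) : nat :=
  match e with
  | Cst _ | Reg _ => 1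
  | Cell e1 => (cost e1).+1
  | Add e1 e2 | Sub e1 e2 => (cost e1 + cost e2).+1
  end.

(* exec P st t st': run from st, P halts in st' after exactly t steps. *)
Inductive exec : cmd -> state -> nat -> state -> Prop :=
| ExecSkip st : exec Skip st 1 st
| ExecSet x e st :
    exec (Set_reg x e) st (cost e).+1
      (State (upd (regs st) x (eval st e)) (heap st))
| ExecStore e1 e2 st :
    exec (Store e1 e2) st (cost e1 + cost e2).+1
      (State (regs st) (upd (heap st) (eval st e1) (eval st e2)))
| ExecSeq P Q st st1 st2 t1 t2 :
    exec P st t1 st1 -> exec Q st1 t2 st2 ->
    exec (Seq P Q) st (t1 + t2).+1 st2
| ExecIf e P Q st st1 t :
    exec (if eval st e != 0 then P else Q) st t st1 ->
    exec (If e P Q) st (cost e + t).+1 st1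
| ExecStop e P st :
    eval st e = 0 -> exec (While e P) st (cost e).+1 st
| ExecLoop e P st st1 st2 t1 t2 :
    eval st e != 0 -> exec P st t1 st1 -> exec (While e P) st1 t2 st2 ->
    exec (While e P) st (cost e + t1 + t2).+1 st2.

(* Input: the list is in the heap from address 0 on, everything else is 0. *)
Definition initial (input : seq nat) : state :=
  State (fun _ => 0) (nth 0 input).

(* Output: the list, preceded by its length, is in the heap from address 0 on;
   the registers and the rest of the heap are arbitrary. *)
Definition outputs (st : state) (output : seq nat) : Prop :=
  heap st 0 = size output /\
  forall k, k < size output -> heap st k.+1 = nth 0 output k.

Definition encode_mv m n (mu : mv m n) : seq nat :=
  [seq nat_of_bool (mu (inl (i, j))) | i <- enum 'I_m.-1, j <- enum 'I_n] ++
  [seq nat_of_bool (mu (inr (i, j))) | i <- enum 'I_m, j <- enum 'I_n.-1].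

Definition encode_input m n (mu1 mu2 : mv m n) : seq nat :=
  [:: m; n] ++ encode_mv mu1 ++ encode_mv mu2.

Definition encode_flips m n (sq : seq (face m n)) : seq nat :=
  flatten [seq [:: nat_of_ord F.1; nat_of_ord F.2] | F <- sq].

(* Main.v *)
(* A locally valid assignment is the same as a height function on the faces,
   changing by 1 or -1 across each crease, up to an additive constant: local
   validity says that the changes around each interior vertex add up to 0.  A
   face can be flipped exactly when it is a local extremum of the height, and the
   flip then changes its height by 2.  Hence, if H1 and H2 are heights of the two
   assignments, equal at the corner, a flip sequence leads from H1 to H2 + c for
   some even constant c and has length at least half of the l1 distance between
   them.  Conversely this length is achieved for each c: as long as some face is
   above its target, a highest such face is a local maximum and can be lowered;
   symmetrically for the faces below their target.  The program tries all c in the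
   relevant range, keeps the one with the least distance, and flips the faces
   level by level. *)

Require Import Defs.
From mathcomp Require Import all_boot all_order all_algebra.
From mathcomp Require Import zify ring.

Set Implicit Arguments.
Unset Strict Implicit.
Unset Printing Implicit Defensive.

Import Order.TTheory GRing.Theory Num.Theory.

Local Notation Sub := Defs.Sub.

(** * Running time *)

(* If no loop of P, each time it is entered, makes more than B iterations, then
   P takes at most coef P * B ^ degree P steps. *)
Fixpoint coef (P : cmd) : nat :=
  match P with
  | Skip => 1
  | Set_reg _ e => (cost e).+1
  | Store e1 e2 => (cost e1 + cost e2).+1
  | Seq P Q => (coef P + coef Q).+1
  | If e P Q => (cost e + (coef P + coef Q)).+1
  | While e P => (coef P + (cost e).+1) + (cost e).+1
  end.

Fixpoint degree (P : cmd) : nat :=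
  match P with
  | Seq P Q | If _ P Q => degree P + degree Q
  | While _ P => (degree P).+1
  | _ => 0
  end.

(** Total correctness with a built-in time bound. The bound depends only on [P] and [B], so
    invariants do not have to count steps. *)
Definition runs (B : nat) (P : cmd) (st : state) (Q : state -> Prop) : Prop :=
  exists t st', [/\ exec P st t st', t <= coef P * B ^ degree P & Q st'].

Fixpoint loopfree (P : cmd) : bool :=
  match P with
  | Seq P Q | If _ P Q => loopfree P && loopfree Q
  | While _ _ => false
  | _ => true
  end.

(** The value on [While] is a dummy: [run] is applied to loop-free programs only, where it turns
    symbolic execution into computation. *)
Fixpoint run (P : cmd) (st : state) : state :=
  match P with
  | Skip | While _ _ => st
  | Set_reg x e => State (upd (regs st) x (eval st e)) (heap st)
  | Store e1 e2 => State (regs st) (upd (heap st) (eval st e1) (eval st e2))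
  | Seq P Q => run Q (run P st)
  | If e P Q => if eval st e != 0 then run P st else run Q st
  end.

Section Runs.
Variables (B : nat) (B_gt0 : 0 < B).
Implicit Types (P : cmd) (st : state) (Q : state -> Prop).

Lemma runs_weaken P st Q Q' :
  runs B P st Q -> (forall st', Q st' -> Q' st') -> runs B P st Q'.
Proof. by move=> [t [st' [? ? /[swap] /[apply] ?]]]; exists t, st'. Qed.

(** Degrees are added rather than maximised: both powers of [B] are at least 1, so each is at most
    their product. *)
Lemma runs_seq P1 P2 st Q :
  runs B P1 st (fun st1 => runs B P2 st1 Q) -> runs B (Seq P1 P2) st Q.
Proof.
move=> [t1 [st1 [e1 l1 [t2 [st2 [e2 l2 q]]]]]].
exists (t1 + t2).+1, st2; split=> //; first exact: ExecSeq e1 e2.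
rewrite /= expnD.
have := expn_gt0 B (degree P1); have := expn_gt0 B (degree P2).
rewrite B_gt0 /=; move: l1 l2; set x := B ^ _; set y := B ^ _; nia.
Qed.

Lemma runs_run P st Q : loopfree P -> Q (run P st) -> runs B P st Q.
Proof.
move=> lf q.
suff [t [tP ex]] : exists t, t <= coef P /\ exec P st t (run P st).
  exists t, (run P st); split=> //.
  by rewrite (leq_trans tP) // leq_pmulr // expn_gt0 B_gt0.
elim: P st lf {q} => [|x e|e1 e2|P1 IH1 P2 IH2|e P1 IH1 P2 IH2|//] st /=.
- by move=> _; exists 1; split=> //; constructor.
- by move=> _; exists (cost e).+1; split=> //; constructor.
- by move=> _; exists (cost e1 + cost e2).+1; split=> //; constructor.
- case/andP=> /IH1-/(_ st) [t1 [l1 e1]] /IH2-/(_ (run P1 st)) [t2 [l2 e2]].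
  by exists (t1 + t2).+1; split; [rewrite ltnS leq_add | exact: ExecSeq e1 e2].
- case/andP=> /IH1-/(_ st) [t1 [l1 e1]] /IH2-/(_ st) [t2 [l2 e2]].
  case: ifP => es; [exists (cost e + t1).+1 | exists (cost e + t2).+1];
    by split; [rewrite ltnS; lia | apply: ExecIf; rewrite es].
Qed.

(** The invariant is indexed by the number of finished iterations, and the loop makes exactly [N] of
    them. *)
Lemma runs_while e P (J : nat -> state -> Prop) N st : N <= B ->
  (forall k st', k < N -> J k st' ->
     eval st' e != 0 /\ runs B P st' (J k.+1)) ->
  (forall st', J N st' -> eval st' e = 0) ->
  J 0 st -> runs B (While e P) st (J N).
Proof.
move=> NB step stop J0.
have expB k : 0 < B ^ k by rewrite expn_gt0 B_gt0.
(* [T] bounds one iteration: the body, the guard and one step of overhead. *)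
set T := (coef P * B ^ degree P + (cost e).+1).
suff [t [st' [ex lt q]]] : exists t st',
    [/\ exec (While e P) st t st', t <= N * T + (cost e).+1 & J N st'].
  exists t, st'; split=> //; apply: leq_trans lt _.
  rewrite /= expnS /T; have := expB (degree P).
  move: (B ^ _) (cost e) (coef P) => y z x y0.
  have : N * (x * y + z.+1) <= B * (x * y + z.+1) by rewrite leq_mul2r NB orbT.
  nia.
suff gen : forall d k st, N = k + d -> J k st -> exists t st',
    [/\ exec (While e P) st t st', t <= d * T + (cost e).+1 & J N st'].
  exact: gen J0.
elim=> [|d IH] k st1 Nk Jk.
  rewrite addn0 in Nk; rewrite -Nk in Jk; exists (cost e).+1, st1.
  by split=> //; apply: ExecStop; apply: stop.
have kN : k < N by rewrite Nk; lia.
have [es [t [st2 [ex2 lt2 /IH]]]] := step _ _ kN Jk.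
rewrite addSnnS => /(_ Nk) [t' [st3 [ex3 lt3 q]]].
exists (cost e + t + t').+1, st3; split=> //; first exact: ExecLoop ex2 ex3.
by rewrite /T mulSn; move: lt2 lt3; rewrite /T; lia.
Qed.

End Runs.

(** * Heights *)

Definition sgb (b : bool) : int := (if b then 1 else -1)%R.

Section Bits.
Variables (m n : nat).
Implicit Type mu : mv m n.

(** Indices are naturals, with value [false] out of range, so that neighbours can be named without
    ordinal proofs. *)
Definition pbit mu (i j : nat) : bool :=
  if (insub i, insub j) is (Some i', Some j') then mu (inl (i', j')) else false.

Definition zbit mu (i j : nat) : bool :=
  if (insub i, insub j) is (Some i', Some j') then mu (inr (i', j')) else false.

Lemma pbitE mu (i : 'I_m.-1) (j : 'I_n) : pbit mu i j = mu (inl (i, j)).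
Proof. by rewrite /pbit !valK. Qed.

Lemma zbitE mu (i : 'I_m) (j : 'I_n.-1) : zbit mu i j = mu (inr (i, j)).
Proof. by rewrite /zbit !valK. Qed.

Lemma pbit_flip mu F i j : i.+1 < m -> j < n ->
  pbit (flip F mu) i j =
    ((j == F.2) && ((i == F.1) || (i.+1 == F.1))) (+) pbit mu i j.
Proof.
case: F => a b; rewrite -ltn_predRL => hi hj.
rewrite -[i]/(nat_of_ord (Ordinal hi)) -[j]/(nat_of_ord (Ordinal hj)) !pbitE ffunE.
suff -> : borders (inl (Ordinal hi, Ordinal hj)) (a, b) =
   (j == b) && ((i == a) || (i.+1 == a)) by case: ifP.
rewrite /borders /= !inE !xpair_eqE; lia.
Qed.

Lemma zbit_flip mu F i j : i < m -> j.+1 < n ->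
  zbit (flip F mu) i j =
    ((i == F.1) && ((j == F.2) || (j.+1 == F.2))) (+) zbit mu i j.
Proof.
case: F => a b; rewrite -ltn_predRL => hi hj.
rewrite -[i]/(nat_of_ord (Ordinal hi)) -[j]/(nat_of_ord (Ordinal hj)) !zbitE ffunE.
suff -> : borders (inr (Ordinal hi, Ordinal hj)) (a, b) =
   (i == a) && ((j == b) || (j.+1 == b)) by case: ifP.
rewrite /borders /= !inE !xpair_eqE; lia.
Qed.

Lemma mv_bits mu1 mu2 :
  (forall i j, i.+1 < m -> j < n -> pbit mu1 i j = pbit mu2 i j) ->
  (forall i j, i < m -> j.+1 < n -> zbit mu1 i j = zbit mu2 i j) -> mu1 = mu2.
Proof.
move=> eqp eqz; apply/ffunP => -[] [i j].
  by rewrite -!pbitE eqp // -ltn_predRL.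
by rewrite -!zbitE eqz // -ltn_predRL.
Qed.

End Bits.

(** * The roles of the creases at a vertex, in coordinates *)

Section Geometry.
Variables (R : realFieldType) (w h s : R).
Hypotheses (hw : (0 < w)%R) (hs : (s != 0)%R).
Variables (m n : nat).
Implicit Type mu : mv m n.

Lemma at_vertex_inr r c (i : 'I_m) (j : 'I_n.-1) :
  at_vertex (r.+1, c.+1) (inr (i, j)) =
    ((i == r :> nat) || (i == r.+1 :> nat)) && (j == c :> nat).
Proof. by rewrite /at_vertex /= !xpair_eqE; lia. Qed.

Lemma at_vertex_inl r c (i : 'I_m.-1) (j : 'I_n) :
  at_vertex (r.+1, c.+1) (inl (i, j)) =
    (i == r :> nat) && ((j == c :> nat) || (j == c.+1 :> nat)).
Proof. by rewrite /at_vertex /= !xpair_eqE; lia. Qed.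

(** Lines [r] and [r.+2] have the same horizontal offset, so both zigzag creases at the vertex lean
    to the same side. *)
Lemma dir_inr r c (i : 'I_m) (j : 'I_n.-1) :
  at_vertex (r.+1, c.+1) (inr (i, j)) ->
  (dir w h s (r.+1, c.+1) (inr (i, j))).1 = (if odd r then s else - s)%R.
Proof.
rewrite at_vertex_inr /dir /other_end /= => /andP[/orP[] /eqP-> /eqP->];
  rewrite !xpair_eqE ?eqxx /= ?(gtn_eqF (ltnSn _)) ?(ltn_eqF (ltnSn _)) /=;
  rewrite /pos /=; case: (odd r) => /=; ring.
Qed.

Lemma dir_inl r c (i : 'I_m.-1) (j : 'I_n) :
  at_vertex (r.+1, c.+1) (inl (i, j)) ->
  dir w h s (r.+1, c.+1) (inl (i, j)) = ((if j == c :> nat then - w else w), 0)%R.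
Proof.
rewrite at_vertex_inl /dir /other_end /= => /andP[/eqP-> /orP[] /eqP->];
  rewrite !xpair_eqE ?eqxx /= ?(gtn_eqF (ltnSn _)) ?(ltn_eqF (ltnSn _)) /=;
  by rewrite /pos /=; congr pair => /=; case: (odd r) => /=; ring.
Qed.

(** [o] tells that the zigzag creases lean to the left at this vertex; then [q] is the left parallel
    crease and [p] the right one. The roles of [a] and [b] are interchangeable, hence the
    disjunction. *)
Lemma rolesP mu r c a b p q : roles w h s (r.+1, c.+1) a b p q ->
  let o := (0 < s)%R (+) odd r in
  [/\ (mu a = zbit mu r c /\ mu b = zbit mu r.+1 c) \/
      (mu b = zbit mu r c /\ mu a = zbit mu r.+1 c),
      mu p = pbit mu r (c + o) &
      mu q = pbit mu r (c + ~~ o)].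
Proof.
case: a b p q => [[? ?]|[ia ja]] [[? ?]|[ib jb]] [[ip jp]|[? ?]] [[iq jq]|[? ?]];
  rewrite /roles /= ?andbF // !andbT /acute /obtuse /dot.
case/and4P=> /and4P[aa ab ap aq] ab' acaq /and3P[_ obap _].
move: acaq obap; rewrite !dir_inr // !dir_inl //= !mulr0 !addr0.
set d := (if odd r then _ else _).
have d0 : d != 0%R by rewrite /d; case: ifP; rewrite ?oppr_eq0.
have od : ((0 < s)%R (+) odd r) = (d < 0)%R.
  rewrite /d; case: (odd r); rewrite ?addbT ?addbF ?oppr_lt0 //.
  by case: ltgtP hs.
move: ap aq;
  rewrite !at_vertex_inl => /andP[/eqP ipr jpc] /andP[/eqP iqr jqc] acq acp.
have jp' : (jp : nat) = c + ((0 < s)%R (+) odd r).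
  rewrite od; move: acp jpc; case: eqP => [-> + _|_ + /= /eqP->].
    by rewrite mulrN oppr_lt0 pmulr_lgt0 // => d1; rewrite lt_gtF ?addn0.
  by rewrite pmulr_llt0 // => ->; rewrite addn1.
have jq' : (jq : nat) = c + ~~ ((0 < s)%R (+) odd r).
  rewrite od; move: acq jqc; case: eqP => [-> + _|_ + /= /eqP->].
    by rewrite mulrN oppr_gt0 pmulr_llt0 // => ->; rewrite addn0.
  by rewrite pmulr_lgt0 // => d1; rewrite lt_gtF ?addn1.
split; rewrite -?pbitE -?zbitE ?ipr ?iqr ?jp' ?jq' //.
move: aa ab; rewrite !at_vertex_inr => /andP[ea /eqP ja'] /andP[eb /eqP jb'].
move: ab'; rewrite (inj_eq inr_inj) xpair_eqE -!val_eqE /= ja' jb' eqxx andbT.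
by case/orP: ea => /eqP->; case/orP: eb => /eqP->; rewrite ?eqxx //; [left|right].
Qed.

End Geometry.

Section Heights.
Variables (m n : nat) (sg : bool).
Implicit Types (mu : mv m n) (H : nat -> nat -> int).

Local Open Scope ring_scope.

(* Change of height from a face to its right (east) or lower (south) neighbour.
   The signs are such that local validity at a vertex says that the changes
   around it add up to 0; sg stands for 0 < s. *)
Definition east mu (i j : nat) : int := sgb (zbit mu i j (+) odd i).
Definition south mu (i j : nat) : int := sgb (pbit mu i j (+) sg).

Definition curl_free mu : Prop := forall r c, (r.+1 < m)%N -> (c.+1 < n)%N ->
  east mu r c + south mu r c.+1 = south mu r c + east mu r.+1 c.

Definition heights mu H : Prop :=
  (forall i j, (i < m)%N -> (j.+1 < n)%N -> H i j.+1 = H i j + east mu i j) /\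
  (forall i j, (i.+1 < m)%N -> (j < n)%N -> H i.+1 j = H i j + south mu i j).

Lemma heights_curl_free mu H : heights mu H -> curl_free mu.
Proof.
move=> [hz hp] r c hr hc.
by have := hz r c (ltnW hr) hc; have := hz r.+1 c hr hc;
   have := hp r c hr (ltnW hc); have := hp r c.+1 hr hc; lia.
Qed.

Definition height mu (i j : nat) : int :=
  \sum_(k < i) south mu k 0 + \sum_(k < j) east mu i k.

(** A discrete Poincare lemma: eastward steps are right by construction, and southward ones pass
    from one column to the next by curl-freeness. *)
Lemma heights_height mu : curl_free mu -> heights mu (height mu).
Proof.
move=> cf.
have hz i j : height mu i j.+1 = height mu i j + east mu i j.
  by rewrite /height big_ord_recr /= addrA.
split=> [i j _ _|i j hi]; first exact: hz.
elim: j => [|j IH] hj; first by rewrite /height !big_ord0 !addr0 big_ord_recr.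
by rewrite !hz IH 1?ltnW //; have := cf i j hi hj; lia.
Qed.

Lemma height00 mu : height mu 0 0 = 0.
Proof. by rewrite /height !big_ord0. Qed.

Lemma heights_bound mu H i j : heights mu H -> (i < m)%N -> (j < n)%N ->
  (`|H i j - H 0 0| <= i + j)%N.
Proof.
move=> [hz hp] + hj; elim: i => [|i IH] hi.
  elim: j hj => [|j IH] hj; first by lia.
  by have := IH (ltnW hj); rewrite hz // /east /sgb; case: ifP => _; lia.
by have := IH (ltnW hi); rewrite hp // /south /sgb; case: ifP => _; lia.
Qed.

Lemma heights_shift mu H H' i j : heights mu H -> heights mu H' ->
  (i < m)%N -> (j < n)%N -> H' i j = H i j + (H' 0 0 - H 0 0).
Proof.
move=> [hz hp] [hz' hp'] + hj; elim: i => [|i IH] hi; last first.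
  by rewrite hp // hp' // (IH (ltnW hi)) addrAC.
elim: j hj => [|j IH] hj; first by rewrite addrC subrK.
by rewrite hz // hz' // (IH (ltnW hj)) addrAC.
Qed.

Lemma sgb_inj : injective sgb. Proof. by do 2!case. Qed.

Lemma heights_inj mu1 mu2 H : heights mu1 H -> heights mu2 H -> mu1 = mu2.
Proof.
move=> [hz hp] [hz' hp']; apply: mv_bits => i j hi hj.
  have : south mu1 i j = south mu2 i j by have := hp i j hi hj; rewrite hp' //; lia.
  by move/sgb_inj/addIb.
have : east mu1 i j = east mu2 i j by have := hz i j hi hj; rewrite hz' //; lia.
by move/sgb_inj/addIb.
Qed.

Lemma eq_heights mu H H' :
  (forall i j, (i < m)%N -> (j < n)%N -> H i j = H' i j) ->
  heights mu H -> heights mu H'.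
Proof.
by move=> E [hz hp]; split=> i j hi hj; rewrite -!E ?hz ?hp // ltnW.
Qed.

Lemma heights_addr mu H c : heights mu H -> heights mu (fun i j => H i j + c).
Proof. by move=> [hz hp]; split=> i j hi hj; rewrite ?hz ?hp // addrAC. Qed.

Lemma east_flip mu (F : face m n) i j : (i < m)%N -> (j.+1 < n)%N ->
  east (flip F mu) i j = if (i == F.1) && ((j == F.2) || (j.+1 == F.2))
    then - east mu i j else east mu i j.
Proof.
by move=> hi hj; rewrite /east zbit_flip //; case: ifP => _;
  case: zbit; case: odd.
Qed.

Lemma south_flip mu (F : face m n) i j : (i.+1 < m)%N -> (j < n)%N ->
  south (flip F mu) i j = if (j == F.2) && ((i == F.1) || (i.+1 == F.1))
    then - south mu i j else south mu i j.
Proof.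
by move=> hi hj; rewrite /south pbit_flip //; case: ifP => _;
  case: pbit; case: sg.
Qed.

(** * Flips and local extrema of the height *)

Definition adjacent (i j i' j' : nat) : bool :=
  (i == i') && ((j == j'.+1) || (j' == j.+1)) ||
  (j == j') && ((i == i'.+1) || (i' == i.+1)).

(* The face (i, j) is a local maximum (e = 1) or minimum (e = -1) of H. *)
Definition extremal H (i j : nat) (e : int) : Prop :=
  forall i' j', (i' < m)%N -> (j' < n)%N -> adjacent i j i' j' ->
  H i' j' = H i j - e.

Definition shift_at H (i j : nat) (d : int) (i' j' : nat) : int :=
  if (i' == i) && (j' == j) then H i j + d else H i' j'.

(** At an extremum all neighbours differ from the face by the same [e], so moving it by [-2e]
    negates exactly the differences across its creases, as [flip] does. *)
Lemma heights_flip mu H (F : face m n) e :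
  heights mu H -> extremal H F.1 F.2 e ->
  heights (flip F mu) (shift_at H F.1 F.2 (- (2 * e))).
Proof.
case: F => [[a ha] [b hb]] [hz hp] /= ext; split=> i j hi hj.
  have := hz _ _ hi hj; rewrite east_flip //= /shift_at.
  have := ext i j hi (ltnW hj); have := ext i j.+1 hi hj; rewrite /adjacent.
  case: (altP (i =P a)) => [->|_] //=; rewrite !eqxx /=.
  case: (altP (j =P b)) => [->|_]; rewrite ?eqxx ?(gtn_eqF (ltnSn _)) ?orbT /=.
    by move=> -> // _; lia.
  by case: (altP (j.+1 =P b)) => [<-|_]; rewrite ?eqxx ?orbT /= => // _ -> //; lia.
have := hp _ _ hi hj; rewrite south_flip //= /shift_at.
have := ext i j (ltnW hi) hj; have := ext i.+1 j hi hj; rewrite /adjacent.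
case: (altP (j =P b)) => [->|_] //=; rewrite ?andbF ?eqxx ?andbT ?orbT //=.
case: (altP (i =P a)) => [->|_]; rewrite ?eqxx ?(gtn_eqF (ltnSn _)) ?orbT /=.
  by move=> -> // _; lia.
by case: (altP (i.+1 =P a)) => [<-|_]; rewrite ?eqxx ?orbT /= => // _ -> //; lia.
Qed.

(* The faces vertically and horizontally next to F share a vertex with F, and
   the sum of the height differences around it vanishes before and after. *)
Lemma flip_corner mu H (F : face m n) i' j' :
  heights mu H -> curl_free (flip F mu) -> (i' < m)%N -> (j' < n)%N ->
  (F.1 == i'.+1 :> nat) || (i' == F.1.+1) ->
  (F.2 == j'.+1 :> nat) || (j' == F.2.+1) ->
  H i' F.2 = H F.1 j'.
Proof.
case: F => [[a ha] [b hb]] /= [hz hp] cf hi hj ai bj.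
(* The minima index the vertex shared by the face and the two neighbours. *)
have hr : ((minn a i').+1 < m)%N by lia.
have hc : ((minn b j').+1 < n)%N by lia.
have := cf _ _ hr hc; rewrite !east_flip ?south_flip //= 1?ltnW //.
have := hz _ _ (ltnW hr) hc; have := hz _ _ hr hc.
have := hp _ _ hr (ltnW hc); have := hp _ _ hr hc.
case/orP: ai => /eqP ea; case/orP: bj => /eqP eb;
  move: (hr) (hc); rewrite ea eb;
  rewrite ?(minn_idPl (leqnSn _)) ?(minn_idPr (leqnSn _));
  rewrite ?eqxx ?(gtn_eqF (ltnSn _)) ?(ltn_eqF (ltnSn _)) ?orbT ?andbT /=; lia.
Qed.

(** By [flip_corner] every vertical neighbour is as high as every horizontal one. With at least two
    rows and two columns both kinds exist, so all neighbours have one common height. *)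
Lemma flip_extremal mu H (F : face m n) : (1 < m)%N -> (1 < n)%N ->
  heights mu H -> curl_free (flip F mu) ->
  exists2 e : int, `|e|%N = 1%N & extremal H F.1 F.2 e.
Proof.
move=> hm hn hH cf.
have hor (k l : nat) : (1 < k)%N -> (l < k)%N ->
    exists2 l', (l' < k)%N & (l == l'.+1) || (l' == l.+1).
  by move=> hk hl; exists (if l is l'.+1 then l' else 1%N); case: l hl => //=; lia.
have [i0 hi0 ai0] := hor _ _ hm (ltn_ord F.1).
have [j0 hj0 aj0] := hor _ _ hn (ltn_ord F.2).
have corner := flip_corner hH cf.
exists (H F.1 F.2 - H i0 F.2).
  case: hH => _ hp; case/orP: ai0 hi0 => /eqP E hi0.
    by have := hp i0 F.2; rewrite -E /south /sgb => ->//; case: ifP => _; lia.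
  by rewrite E hp -?E // /south /sgb; case: ifP => _; lia.
move=> i' j' hi' hj'; rewrite /adjacent => /orP[]/andP[/eqP <- A].
  by rewrite -(corner i0 j') //; lia.
by rewrite (corner i' j0) // -(corner i0 j0) //; lia.
Qed.

Lemma heights_adjacent mu H i j i' j' : heights mu H ->
  (i < m)%N -> (j < n)%N -> (i' < m)%N -> (j' < n)%N -> adjacent i j i' j' ->
  `|H i' j' - H i j|%N = 1%N.
Proof.
move=> [hz hp] hi hj hi' hj'; rewrite /adjacent.
case/orP=> /andP[/eqP E /orP[] /eqP E']; subst; rewrite ?hz ?hp // /east /south /sgb;
  by case: ifP => _; lia.
Qed.

(** Both heights change by an odd amount at each step, so their difference stays even. Hence a face
    off its target is at least 2 away, and a flip towards the target never overshoots. *)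
Lemma heights_even mu mu' H H' i j : heights mu H -> heights mu' H' ->
  H 0 0 = H' 0 0 -> (i < m)%N -> (j < n)%N -> exists c : int, H' i j = H i j + 2 * c.
Proof.
move=> [hz hp] [hz' hp'] E + hj; elim: i => [|i IH] hi; last first.
  have [c Ec] := IH (ltnW hi); rewrite hp // hp' // Ec /south /sgb.
  by case: ifP; case: ifP; [exists c|exists (c + 1)|exists (c - 1)|exists c]; lia.
elim: j hj => [|j IH] hj; first by exists 0; rewrite E mulr0 addr0.
have [c Ec] := IH (ltnW hj); rewrite hz // hz' // Ec /east /sgb.
by case: ifP; case: ifP; [exists c|exists (c + 1)|exists (c - 1)|exists c]; lia.
Qed.

(* A highest face among those above the target t is a local maximum: a higher
   neighbour would be one above its own target as well. *)
Lemma extremal_above mu mu' a t i j (e : int) : `|e|%N = 1%N ->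
  heights mu a -> heights mu' t -> (i < m)%N -> (j < n)%N ->
  (exists c : int, t i j = a i j + 2 * c) -> 0 < e * (a i j - t i j) ->
  (forall i' j', (i' < m)%N -> (j' < n)%N -> 0 < e * (a i' j' - t i' j') ->
     e * a i' j' <= e * a i j) ->
  extremal a i j e.
Proof.
move=> e1 ha ht hi hj [c ec] pos top i' j' hi' hj' adj.
have := heights_adjacent ha hi hj hi' hj' adj.
have := heights_adjacent ht hi hj hi' hj' adj.
have := top _ _ hi' hj'; move: pos; rewrite ec.
have [->|->] : e = 1 \/ e = -1 by lia.
  rewrite !mul1r; case: (ltrP 0 (a i' j' - t i' j')) => [_ + /(_ isT)|]; lia.
rewrite !mulN1r; case: (ltrP 0 (- (a i' j' - t i' j'))) => [_ + /(_ isT)|]; lia.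
Qed.

(** * The l1 distance and the lower bound on the number of flips *)

Definition dist H H' : nat :=
  \sum_(k < m * n) `|H (k %/ n)%N (k %% n)%N - H' (k %/ n)%N (k %% n)%N|%N.

Lemma cell_in (k : 'I_(m * n)) : (k %/ n < m)%N && (k %% n < n)%N.
Proof.
case: k => k /= hk; have n0 : (0 < n)%N by case: n hk; rewrite ?muln0.
by rewrite ltn_divLR // hk ltn_mod n0.
Qed.

Lemma leq_dist H1 H2 H1' H2' :
  (forall i j, (i < m)%N -> (j < n)%N ->
     (`|H1 i j - H1' i j| <= `|H2 i j - H2' i j|)%N) ->
  (dist H1 H1' <= dist H2 H2')%N.
Proof.
by move=> le; apply: leq_sum => k _; have /andP[] := cell_in k; apply: le.
Qed.

Lemma dist_triangle H1 H2 H3 : (dist H1 H3 <= dist H1 H2 + dist H2 H3)%N.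
Proof. by rewrite -big_split; apply: leq_sum => k _ /=; lia. Qed.

(** Only one summand changes; the additive form avoids truncated subtraction. *)
Lemma dist_shift_at H H' i j d : (i < m)%N -> (j < n)%N ->
  (dist (shift_at H i j d) H' + `|H i j - H' i j| =
   dist H H' + `|(H i j + d)%R - H' i j|)%N.
Proof.
move=> hi hj; have hk : (i * n + j < m * n)%N by nia.
have [qk rk] : ((i * n + j) %/ n = i /\ (i * n + j) %% n = j)%N.
  rewrite divnMDl ?(leq_ltn_trans _ hj) // divn_small //.
  by rewrite modnMDl modn_small ?addn0.
rewrite /dist (bigD1 (Ordinal hk)) //= [in RHS](bigD1 (Ordinal hk)) //=.
rewrite qk rk /shift_at !eqxx /=.
set A := (\sum_(k < _ | _) _)%N; set B := (\sum_(k < _ | _) _)%N.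
suff -> : A = B by lia.
apply: eq_bigr => k neq; case: andP => // -[/eqP E1 /eqP E2].
by case/negP: neq; rewrite -val_eqE /= -E1 -E2 -divn_eq.
Qed.

Definition valid_flips mu (sq : seq (face m n)) : Prop :=
  forall k, (k <= size sq)%N -> curl_free (flips mu (take k sq)).

Lemma valid_flips_cons mu F sq : valid_flips mu (F :: sq) ->
  curl_free mu /\ valid_flips (flip F mu) sq.
Proof.
by move=> val; split=> [|k hk]; [have := val 0 | have := val k.+1]; apply.
Qed.

Lemma valid_flips_rcons mu F sq : valid_flips mu sq ->
  curl_free (flip F (flips mu sq)) -> valid_flips mu (rcons sq F).
Proof.
move=> val cf k; rewrite size_rcons leq_eqVlt => /predU1P[->|hk].
  by rewrite -(size_rcons sq F) take_size /flips foldl_rcons.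
by rewrite -cats1 takel_cat //; apply: val.
Qed.

(** The height is followed through the sequence, each flip moving a single face by 2. The corner
    thus moves by an even amount, which may be nonzero. *)
Lemma valid_flips_dist mu H sq : (1 < m)%N -> (1 < n)%N ->
  heights mu H -> valid_flips mu sq -> exists H',
  [/\ heights (flips mu sq) H', (dist H H' <= 2 * size sq)%N &
      exists c : int, H' 0 0 = H 0 0 + 2 * c].
Proof.
move=> hm hn; elim: sq mu H => [|F sq IH] mu H hH val.
  exists H; split=> //; first by rewrite /dist big1 // => k _; lia.
  by exists 0; lia.
have [_ val'] := valid_flips_cons val; have cf := val' 0 isT.
rewrite take0 in cf; have [e e1 ext] := flip_extremal hm hn hH cf.
have [H' [hH' d' [c' hc']]] := IH _ _ (heights_flip hH ext) val'.
exists H'; split=> //=.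
  apply: leq_trans (dist_triangle _ (shift_at H F.1 F.2 (- (2 * e))) _) _.
  rewrite mulnS leq_add //.
  have := dist_shift_at H H (- (2 * e)) (ltn_ord F.1) (ltn_ord F.2).
  have -> : dist H H = 0%N by rewrite /dist big1 // => k _; lia.
  suff -> : dist H (shift_at H F.1 F.2 (- (2 * e))) =
    dist (shift_at H F.1 F.2 (- (2 * e))) H by lia.
  by apply: eq_bigr => k _; lia.
rewrite hc' /shift_at; case: ifP => [/andP[/eqP<- /eqP<-]|_];
  by [exists (c' - e); lia|exists c'; lia].
Qed.

(** The differences lie between [-2S] and [2S], so a shift [2C] outside this range is, at every
    face, no better than the nearest end of the range. The offsets [3S] and [S] amount to
    [C = c - S], so that [c] is a natural number. *)
Lemma dist_clamp H1 H2 (S : nat) (C : int) :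
  (forall i j, (i < m)%N -> (j < n)%N -> (`|H1 i j - H2 i j| <= 2 * S)%N) ->
  exists2 c : nat, (c <= 2 * S)%N &
    (dist (fun i j => H1 i j + (3 * S)%N)%R
          (fun i j => H2 i j + (S + 2 * c)%N)%R
      <= dist H1 (fun i j => H2 i j + 2 * C)%R)%N.
Proof.
move=> bnd.
have [c cS cC] : exists2 c : nat, (c <= 2 * S)%N & [\/ c%:Z = C + S,
    c = 0%N /\ C + S < 0 | c = (2 * S)%N /\ (2 * S)%N%:Z < C + S].
  have [lt|ge] := ltrP (C + S) 0; first by exists 0%N => //; constructor 2.
  have [gt|le] := ltrP (2 * S)%N%:Z (C + S).
    by exists (2 * S)%N => //; constructor 3.
  by exists `|(C + S)%R|%N; [|constructor 1]; lia.
exists c => //; apply: leq_dist => i j hi hj.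
by have := bnd i j hi hj; case: cC; lia.
Qed.

End Heights.

(** Both conditions concern the four bits at one vertex. [rolesP] matches these bits with the roles,
    and [roles_exist] lets local validity be applied at every interior vertex; the rest is a finite
    check. *)
Lemma locally_validE (R : realFieldType) (w h s : R) m n (mu : mv m n) :
  (0 < w)%R -> (s != 0)%R ->
  locally_valid w h s mu <-> curl_free (0 < s)%R mu.
Proof.
move=> hw hs; split=> [val r c hr hc|].
  have int : interior m n (r.+1, c.+1) by rewrite /interior /= hr hc.
  have [a [b [p [q ro]]]] := roles_exist h hw hs int.
  have [] := val _ int _ _ _ _ ro; have [ab -> ->] := rolesP hw hs mu ro.
  rewrite /east /south /=; case: ab => -[-> ->];
  case: (0 < s)%R; case: (odd r); rewrite /= ?addn0 ?addn1;
  case: (zbit mu r c); case: (zbit mu r.+1 c);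
  case: (pbit mu r c); case: (pbit mu r c.+1) => //= _ /(_ erefl) //.
move=> cf [r c] /andP[/andP[r0 hr] /andP[c0 hc]] a b p q.
case: r c r0 c0 hr hc => [//|r] [//|c] _ _ hr hc ro.
have [ab -> ->] := rolesP hw hs mu ro.
have := cf r c hr hc; rewrite /east /south /=; case: ab => -[-> ->];
  case: (0 < s)%R; case: (odd r); rewrite /= ?addn0 ?addn1;
  case: (zbit mu r c); case: (zbit mu r.+1 c);
  case: (pbit mu r c); case: (pbit mu r c.+1) => //=.
Qed.

(** * The program *)

(* rK is the index i * n + j of the current face, rI is i, rJ is j and rP is the
   parity of i. *)
Local Notation rK := 0 (only parsing).
Local Notation rI := 1 (only parsing).
Local Notation rJ := 2 (only parsing).
Local Notation rP := 3 (only parsing).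
Local Notation rX := 4 (only parsing).
Local Notation rM := 5 (only parsing).
Local Notation rN := 6 (only parsing).
Local Notation rSrc := 7 (only parsing).
Local Notation rDst := 8 (only parsing).
Local Notation rOff := 9 (only parsing).
Local Notation rC := 10 (only parsing).
Local Notation rCost := 11 (only parsing).
Local Notation rBest := 12 (only parsing).
Local Notation rArg := 13 (only parsing).
Local Notation rOut := 14 (only parsing).
Local Notation rLvl := 15 (only parsing).

(** The machine has no division, so the row, the column and the parity of the row are updated along
    with the face index. *)
Definition advance : cmd :=
  Seq (Set_reg rK (Add (Reg rK) (Cst 1)))
 (Seq (Set_reg rJ (Add (Reg rJ) (Cst 1)))
      (If (Sub (Reg rN) (Reg rJ)) Skip
     (Seq (Set_reg rJ (Cst 0))
     (Seq (Set_reg rI (Add (Reg rI) (Cst 1)))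
          (Set_reg rP (Sub (Cst 1) (Reg rP))))))).

Definition reset : cmd :=
  Seq (Set_reg rK (Cst 0)) (Seq (Set_reg rI (Cst 0))
 (Seq (Set_reg rJ (Cst 0)) (Set_reg rP (Cst 0)))).

Definition sweep (body : cmd) : cmd :=
  Seq reset (While (Sub (Reg rX) (Reg rK)) (Seq body advance)).

Section Sweep.
Variables (B m n : nat) (B_gt0 : 0 < B) (mnB : m * n <= B) (n_gt0 : 0 < n).

Definition cursor (i j : nat) (st : state) : Prop :=
  [/\ regs st rK = i * n + j, regs st rI = i, regs st rJ = j,
      regs st rP = odd i & regs st rX = m * n /\ regs st rN = n].

Lemma cell_unique i j i' j' : j < n -> j' < n ->
  (i * n + j == i' * n + j') = (i == i') && (j == j').
Proof.
move=> hj hj'; apply/eqP/andP => [e|[/eqP-> /eqP->] //].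
have : (i * n + j) %/ n = (i' * n + j') %/ n by rewrite e.
rewrite !divnMDl // !divn_small // !addn0 => ei.
by move: e; rewrite ei eqxx => /addnI->.
Qed.

(** The loop rule for a pass in row-major order. The sweep owns registers 0 to 3: [J] may not depend
    on them, and the body must preserve the cursor. *)
Lemma runs_sweep body (J : nat -> state -> Prop) st : loopfree body ->
  (forall k st st', J k st -> heap st' = heap st ->
     (forall x, 3 < x -> regs st' x = regs st x) -> J k st') ->
  (forall i j st, i < m -> j < n -> cursor i j st -> J (i * n + j) st ->
     let st' := run body st in cursor i j st' /\ J (i * n + j).+1 st') ->
  regs st rX = m * n -> regs st rN = n -> J 0 st ->
  runs B (sweep body) st (J (m * n)).
Proof.
move=> lf ext step stX stN J0.
pose J' k st := cursor (k %/ n) (k %% n) st /\ J k st.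
apply: (runs_seq B_gt0); apply: (runs_run B_gt0) => //.
suff run_loop st1 : J' 0 st1 ->
    runs B (While (Sub (Reg rX) (Reg rK)) (Seq body advance)) st1 (J' (m * n)).
  apply: runs_weaken (run_loop _ _) _; last by move=> ? [].
  split; first by rewrite div0n mod0n /cursor /=.
  by apply: ext J0 _ _ => //= -[|[|[|[|]]]].
apply: (runs_while B_gt0) => //= [k {}st1 hk [cur Jk]|{}st1 [cur _]]; last first.
  by case: cur => -> _ _ _ [-> _]; rewrite -divn_eq subnn.
have im : k %/ n < m by rewrite ltn_divLR.
have jn : k %% n < n by rewrite ltn_mod.
split; first by case: cur => -> _ _ _ [-> _]; rewrite -divn_eq -lt0n subn_gt0.
rewrite [k in J k](divn_eq k n) in Jk.
have [cur' J'k] := step _ _ _ im jn cur Jk.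
apply: (runs_run B_gt0); first by rewrite /= lf.
rewrite [run _ _]/=; move: (run body st1) cur' J'k => st2 [eK eI eJ eP [eX eN]].
rewrite /J' -divn_eq => Jk1.
(* The next quotient and remainder, applied once inside a row and once at its end. *)
have ds : forall q r, r < n -> k.+1 = q * n + r -> k.+1 %/ n = q /\ k.+1 %% n = r.
  by move=> q r hr ->; rewrite divnMDl // divn_small // modnMDl modn_small // addn0.
have := divn_eq k n.
set q := k %/ n in eK eI eP *; set r := k %% n in jn eK eJ * => kE.
split; last by apply: ext Jk1 _ _; rewrite /upd /=;
  [case: ifP | case: ifP => _ -[|[|[|[|x]]]]].
rewrite /upd /= eN eJ; case: ifP => [lt|ge].
  have [-> ->] := ds q r.+1 ltac:(lia) ltac:(lia).
  by rewrite /cursor /= eK eI eP eX; split=> //; rewrite ?eN; lia.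
have [-> ->] := ds q.+1 0 ltac:(lia) ltac:(lia).
rewrite /cursor /= eK eI eP eX; split=> //; rewrite ?eN; try lia.
Qed.

End Sweep.

(** * Computing the heights in memory *)

Definition absdiff (e1 e2 : expr) : expr := Add (Sub e1 e2) (Sub e2 e1).

(** For a bit [d] this is [e + sgb d], exact as long as [e] is positive. On bits [absdiff] is
    exclusive or, which supplies the argument of [sgb] in [east] and [south]. *)
Definition move_by (e d : expr) : expr := Sub (Add e (Add d d)) (Cst 1).

(** The west neighbour is used, or the north one in column 0, as along the path of [height]. In the
    zigzag block the bit west of face [(i, j)] has index [i * (n - 1) + j - 1], which is the face
    index minus [i + 1] and so takes no multiplication. *)
Definition store_height (sg : bool) : cmd :=
  let here := Add (Reg rDst) (Reg rK) in
  If (Reg rJ)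
    (Store here (move_by (Cell (Sub here (Cst 1)))
      (absdiff (Cell (Sub (Add (Reg rSrc) (Add (Sub (Reg rX) (Reg rN)) (Reg rK)))
                          (Add (Reg rI) (Cst 1)))) (Reg rP))))
  (If (Reg rI)
    (Store here (move_by (Cell (Sub here (Reg rN)))
      (absdiff (Cell (Sub (Add (Reg rSrc) (Reg rK)) (Reg rN))) (Cst sg))))
    (Store here (Reg rOff))).

Definition same_regs (f g : nat -> nat) : Prop := forall x, 3 < x -> f x = g x.

Section StoreHeights.
Variables (B m n : nat) (B_gt0 : 0 < B) (mnB : m * n <= B).
Hypotheses (m_gt0 : 0 < m) (n_gt0 : 0 < n).

Definition mv_at (mem : nat -> nat) (a : nat) (mu : mv m n) : Prop :=
  (forall i j, i.+1 < m -> j < n -> mem (a + (i * n + j)) = pbit mu i j) /\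
  (forall i j, i < m -> j.+1 < n ->
     mem (a + (m * n - n) + (i * n.-1 + j)) = zbit mu i j).

Definition heights_at (mem : nat -> nat) (a : nat) (H : nat -> nat -> int) : Prop :=
  forall i j, i < m -> j < n -> Posz (mem (a + (i * n + j))) = H i j.

(** An offset of at least [m + n] keeps every height positive, so [move_by] does not truncate; the
    source ends before the destination begins, so its bits survive. *)
Lemma runs_store_heights sg mu st :
  regs st rX = m * n -> regs st rN = n -> m + n <= regs st rOff ->
  regs st rSrc + (m * n - n + m * n.-1) <= regs st rDst ->
  mv_at (heap st) (regs st rSrc) mu -> curl_free sg mu ->
  runs B (sweep (store_height sg)) st (fun st' =>
    [/\ same_regs (regs st') (regs st),
        forall x, x < regs st rDst \/ regs st rDst + m * n <= x ->
          heap st' x = heap st x &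
        heights_at (heap st') (regs st rDst)
          (fun i j => height sg mu i j + Posz (regs st rOff))%R]).
Proof.
move=> eX eN offP srcP [atp atz] cf.
pose J k st' := [/\ same_regs (regs st') (regs st),
  forall x, x < regs st rDst \/ regs st rDst + m * n <= x ->
          heap st' x = heap st x &
  forall i j, i < m -> j < n -> i * n + j < k ->
    Posz (heap st' (regs st rDst + (i * n + j)))
      = (height sg mu i j + Posz (regs st rOff))%R].
have hH := heights_height cf.
apply: (@runs_weaken _ _ _ (J (m * n))); last first.
  by move=> st' [? ? hJ]; split=> // i j hi hj; apply: hJ => //; nia.
apply: (runs_sweep B_gt0 mnB n_gt0) => //; first 1 last.
- move=> i j {}st' hi hj [eK eI eJ eP [eX' eN']] [rs mem cells].
  have eDst := rs 8 isT; have eSrc := rs 7 isT; have eOff := rs 9 isT.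
  have [v -> vE] : exists2 v, run (store_height sg) st' =
      State (regs st') (upd (heap st') (regs st rDst + (i * n + j)) v) &
      Posz v = (height sg mu i j + Posz (regs st rOff))%R.
    rewrite /= eJ eI eK eP eX' eN' eDst eSrc eOff.
    case: j hj eK eJ cells => [|j] hj eK eJ cells /=; last first.
      eexists; first by [].
      have -> : regs st rSrc + (m * n - n + (i * n + j.+1)) - (i + 1) =
          regs st rSrc + (m * n - n) + (i * n.-1 + j).
        have : i * n = i * n.-1 + i by rewrite -{1}(prednK n_gt0) mulnS addnC.
        by move: (m * n - n) (i * n) (i * n.-1) => x y z ->; lia.
      have -> : regs st rDst + (i * n + j.+1) - 1 =
          regs st rDst + (i * n + j) by lia.
      rewrite (mem (regs st rSrc + _ + _)); last first.
        have : i.+1 * n.-1 <= m * n.-1 by rewrite leq_mul2r hi orbT.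
        rewrite mulSn => le; left; move: le srcP hj; rewrite -ltn_predRL.
        by move: (n.-1) (i * n.-1) (m * n.-1) (m * n - n); clear; lia.
      rewrite atz //; have := cells i j hi (ltnW hj) ltac:(lia).
      have := heights_bound hH hi (ltnW hj); rewrite height00.
      rewrite hH.1 // /east /sgb; move: (zbit _ _ _) (odd i) => [] []/=; lia.
    case: i hi eK eI eP cells => [|i] hi eK eI eP cells /=.
      by eexists => //; rewrite height00 add0r.
    eexists; first by [].
    have -> : regs st rSrc + (i.+1 * n + 0) - n = regs st rSrc + (i * n + 0) by lia.
    have -> : regs st rDst + (i.+1 * n + 0) - n = regs st rDst + (i * n + 0) by lia.
    rewrite (mem (regs st rSrc + _)); last first.
      have : i.+2 * n <= m * n by rewrite leq_mul2r hi orbT.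
      by rewrite !mulSn => le; left; move: le srcP n_gt0; clear; lia.
    rewrite atp //; have := cells i 0 (ltnW hi) hj ltac:(lia).
    have := heights_bound hH (ltnW hi) hj; rewrite height00.
    rewrite hH.2 // /south /sgb; move: (pbit _ _ _) (sg) => [] []/=; lia.
  split; first by split.
  split=> //= [x hx|i' j' hi' hj' lt]; rewrite /upd /=.
    by case: eqP hx => [->|_ /mem //]; nia.
  rewrite eqn_add2l cell_unique //; case: andP => [[/eqP-> /eqP->] //|neq].
  apply: cells => //; rewrite ltn_neqAle cell_unique //; case: andP neq => //; lia.
move=> k st1 st2 [rs mem cells] Eh Er; split=> [x hx|x hx|i j hi hj lt].
- by rewrite Er ?rs.
- by rewrite Eh mem.
- by rewrite Eh cells.
Qed.
End StoreHeights.

(* With X = m * n, the heights of the two assignments are kept in the cells from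
   4 * X and from 5 * X on, and the flips are logged from 6 * X on: the input
   ends before 4 * X, and the log, of unknown length, comes last. *)
Definition base1 : expr := Add (Add (Reg rX) (Reg rX)) (Add (Reg rX) (Reg rX)).
Definition base2 : expr := Add base1 (Reg rX).
Definition log_base : expr := Add base2 (Reg rX).
Definition current : expr := Cell (Add base1 (Reg rK)).
Definition target : expr :=
  Add (Cell (Add base2 (Reg rK))) (Add (Reg rC) (Reg rC)).
Definition perimeter : expr := Add (Reg rM) (Reg rN).

(** * The search for the best constant *)

Definition add_cost : cmd :=
  Set_reg rCost (Add (Reg rCost) (absdiff current target)).

(** The test for an update also succeeds at [rC = 0], so the first candidate is always accepted;
    this stands in for an infinite initial cost. *)
Definition best_shift : cmd :=
  Seq (Set_reg rC (Cst 0))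
 (Seq (While (Sub (Add (Add perimeter perimeter) (Cst 1)) (Reg rC))
   (Seq (Set_reg rCost (Cst 0))
   (Seq (sweep add_cost)
   (Seq (If (Add (Sub (Cst 1) (Reg rC)) (Sub (Reg rBest) (Reg rCost)))
          (Seq (Set_reg rBest (Reg rCost)) (Set_reg rArg (Reg rC))) Skip)
        (Set_reg rC (Add (Reg rC) (Cst 1)))))))
      (Set_reg rC (Reg rArg))).

Definition sizes (m n : nat) (f : nat -> nat) : Prop :=
  [/\ f rX = m * n, f rM = m & f rN = n].

Definition shift_cost (X : nat) (mem : nat -> nat) (c : nat) : nat :=
  \sum_(q < X) `|mem (4 * X + q) - (mem (5 * X + q) + 2 * c)|.

Section BestShift.
Variables (B m n : nat) (B_gt0 : 0 < B) (mnB : m * n <= B) (n_gt0 : 0 < n).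
Hypothesis SB : 2 * (m + n) < B.

Lemma runs_cost st : sizes m n (regs st) -> regs st rCost = 0 ->
  runs B (sweep add_cost) st (fun st' =>
    [/\ heap st' = heap st,
        forall x, 3 < x -> x != rCost -> regs st' x = regs st x &
        regs st' rCost = shift_cost (m * n) (heap st) (regs st rC)]).
Proof.
move=> [eX eM eN] c0.
pose J k st' := [/\ heap st' = heap st,
  forall x, 3 < x -> x != rCost -> regs st' x = regs st x &
  regs st' rCost = \sum_(q < k) `|heap st (4 * (m * n) + q)
    - (heap st (5 * (m * n) + q) + 2 * regs st rC)|].
apply: (runs_sweep (J := J) B_gt0 mnB n_gt0) => //.
- move=> k st1 st2 [mem rs ec] Eh Er.
  split=> [|x hx hx'|]; first by rewrite Eh.
    by rewrite Er // rs.
  by rewrite Er.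
- move=> i j {}st' hi hj cur [mem rs ec]; split; first by case: cur.
  split=> //=; first by move=> x hx hx'; rewrite /upd ifN ?rs.
  have [-> _ _ _ [-> _]] := cur.
  rewrite /upd /= big_ord_recr /= -ec mem (rs 10 isT isT).
  set X := m * n.
  have -> : X + X + (X + X) + X = 5 * X by lia.
  have -> : X + X + (X + X) = 4 * X by lia.
  by congr addn; lia.
- by split=> //; rewrite big_ord0.
Qed.

Lemma runs_best_shift st : sizes m n (regs st) ->
  runs B best_shift st (fun st' =>
    [/\ sizes m n (regs st'), heap st' = heap st, regs st' rC <= 2 * (m + n) &
        forall c, c <= 2 * (m + n) ->
          shift_cost (m * n) (heap st) (regs st' rC) <=
          shift_cost (m * n) (heap st) c]).
Proof.
move=> sz; pose f := shift_cost (m * n) (heap st).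
(* Before the first round [rBest] is meaningless, hence the premise [0 < k]. *)
pose J k st' := [/\ sizes m n (regs st'), heap st' = heap st, regs st' rC = k &
  0 < k -> [/\ regs st' rBest = f (regs st' rArg), regs st' rArg < k &
              forall c, c < k -> regs st' rBest <= f c]].
apply: (runs_seq B_gt0); apply: (runs_run B_gt0) => //.
apply: (runs_seq B_gt0); apply: (@runs_weaken _ _ _ (J (2 * (m + n)).+1)).
  apply: (runs_while B_gt0) => [//|k {}st' hk|st' [[_ eM eN] _ eC _]|].
  - move=> [[eX eM eN] Eh eC best]; split; first by rewrite /= eM eN eC; lia.
    apply: (runs_seq B_gt0); apply: (runs_run B_gt0) => //.
    apply: (runs_seq B_gt0); apply: (runs_weaken (runs_cost _ _)) => //.
    move=> st1 [/= Eh1 rs1 ec1]; apply: (runs_run B_gt0) => //.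
    have [[r4 r5] r6] := (rs1 4 isT isT, rs1 5 isT isT, rs1 6 isT isT).
    have [[r10 r12] r13] := (rs1 10 isT isT, rs1 12 isT isT, rs1 13 isT isT).
    rewrite /upd /= in r4 r5 r6 r10 r12 r13 ec1.
    rewrite Eh eC -/(f k) in ec1.
    rewrite /J /sizes /= r10 r12 ec1 eC; case: ifP => upd_best; rewrite /upd /=.
      rewrite r4 r5 r6 ?r10 ?eC ?ec1 Eh1 Eh addn1; split=> // _; split=> // c.
      rewrite ltnS leq_eqVlt => /predU1P[-> //|hc].
      have [_ _ le] := best (leq_ltn_trans (leq0n c) hc).
      by apply: leq_trans (le c hc); move: hc upd_best; lia.
    rewrite r4 r5 r6 ?r10 r12 r13 ?eC Eh1 Eh addn1; split=> // _.
    have k0 : 0 < k by lia.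
    have [eb la le] := best k0; split=> [//||c]; first exact: leqW.
    by rewrite ltnS leq_eqVlt => /predU1P[->|/le //]; lia.
  - by rewrite /= eM eN eC; lia.
  - by split.
move=> st' [sz' Eh eC] /(_ isT) [eb la best]; apply: (runs_run B_gt0) => //.
by split=> // c hc; rewrite /= -/(f _) -eb; apply: best.
Qed.
End BestShift.

(** * Flipping level by level *)

Definition flip_here (up : bool) : cmd :=
  Seq (Store (Add base1 (Reg rK))
         (if up then Add current (Cst 2) else Sub current (Cst 2)))
 (Seq (Store (Reg rOut) (Reg rI))
 (Seq (Store (Add (Reg rOut) (Cst 1)) (Reg rJ))
      (Set_reg rOut (Add (Reg rOut) (Cst 2))))).

Definition flip_level (up : bool) : cmd :=
  sweep (If (if up then Sub target current else Sub current target)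
           (If (absdiff current (Reg rLvl)) Skip (flip_here up)) Skip).

(** The starting level [4 * (m + n)] bounds the initial heights: at most [m + n], plus the offset
    [3 * (m + n)]. *)
Definition flip_down : cmd :=
  Seq (Set_reg rLvl (Add (Add perimeter perimeter) (Add perimeter perimeter)))
      (While (Reg rLvl)
         (Seq (flip_level false) (Set_reg rLvl (Sub (Reg rLvl) (Cst 1))))).

(** Targets are at most [6 * (m + n)]: [m + n] for the height, [m + n] for the offset, and
    [4 * (m + n)] for the largest shift. *)
Definition flip_up : cmd :=
  Seq (Set_reg rLvl (Cst 0))
      (While (Sub (Add (Add perimeter perimeter) (Add (Add perimeter perimeter)
                   (Add perimeter perimeter))) (Reg rLvl))
         (Seq (flip_level true) (Set_reg rLvl (Add (Reg rLvl) (Cst 1))))).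

Lemma encode_flips_rcons m n (sq : seq (face m n)) F :
  encode_flips (rcons sq F) = encode_flips sq ++ [:: F.1 : nat; F.2 : nat].
Proof. by rewrite /encode_flips map_rcons flatten_rcons. Qed.

Lemma size_encode_flips m n (sq : seq (face m n)) :
  size (encode_flips sq) = 2 * size sq.
Proof.
elim/last_ind: sq => // sq F IH.
by rewrite encode_flips_rcons size_cat IH size_rcons mulnS addnC.
Qed.

Lemma upd_eq f x v : upd f x v x = v.
Proof. by rewrite /upd eqxx. Qed.

Lemma upd_neq f x v y : y != x -> upd f x v y = f y.
Proof. by rewrite /upd => /negbTE->. Qed.

Section FlipLevel.
Variables (B m n : nat) (B_gt0 : 0 < B) (mnB : m * n <= B) (n_gt0 : 0 < n).
Variables (sg : bool) (mu1 mu2 : mv m n) (t : nat -> nat -> int) (c D : nat).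
Hypothesis ht : heights sg mu2 t.

(** The invariant of both flipping phases: [sq] is the log so far and [a] the heights it leads to.
    As [D] is constant, each flip brings the heights closer to the target by exactly 2, so the final
    log has length half of [D]. Memory holds the targets without the shift [2 * c]. *)
Record partial (sq : seq (face m n)) (a : nat -> nat -> int) (st : state) : Prop :=
  Partial {
    partial_sizes : sizes m n (regs st);
    partial_shift : regs st rC = c;
    partial_out : regs st rOut = 6 * (m * n) + 2 * size sq;
    partial_valid : valid_flips sg mu1 sq;
    partial_heights : heights sg (flips mu1 sq) a;
    partial_even : forall i j, i < m -> j < n ->
      exists d : int, t i j = (a i j + 2 * d)%R;
    partial_dist : 2 * size sq + dist m n a t = D;
    partial_current : heights_at m n (heap st) (4 * (m * n)) a;
    partial_target :
      heights_at m n (heap st) (5 * (m * n)) (fun i j => t i j - Posz (2 * c))%R;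
    partial_log : forall q, q < 2 * size sq ->
      heap st (6 * (m * n) + q) = nth 0 (encode_flips sq) q }.

Lemma partial_ext sq a st st' : partial sq a st ->
  heap st' = heap st -> (forall x, 3 < x < rLvl -> regs st' x = regs st x) ->
  partial sq a st'.
Proof.
case=> [[eX eM eN] ? ? ? ? ? ? ? ? ?] Eh Er; split; rewrite ?Eh ?Er //.
by split; rewrite Er.
Qed.

Definition sign (up : bool) : int := (if up then -1 else 1)%R.

(* In a sweep at height l the faces on the wrong side of their target are at
   most at height l (at least, if up), strictly so if already visited. *)
Definition levelled (up : bool) (l k : nat) (a : nat -> nat -> int) : Prop :=
  (up -> forall i j, i < m -> j < n -> (a i j <= t i j)%R) /\
  (forall i j, i < m -> j < n -> (0 < sign up * (a i j - t i j))%R ->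
     (sign up * a i j <= sign up * Posz l)%R /\
     (i * n + j < k -> (sign up * a i j < sign up * Posz l)%R)).

(** By [levelled], a face met at height [l] on the wrong side is an extreme one among such faces, so
    [extremal_above] allows its flip. The flip moves it off level [l] in the direction of the sweep,
    so the strict bound on visited faces holds. *)
Lemma runs_flip_level up l sq a st :
  partial sq a st -> levelled up l 0 a -> regs st rLvl = l ->
  runs B (flip_level up) st (fun st' => exists sq' a',
    [/\ partial sq' a' st', levelled up l (m * n) a' & regs st' rLvl = l]).
Proof.
move=> pa lev eL.
pose J k st' := exists sq' a',
  [/\ partial sq' a' st', levelled up l k a' & regs st' rLvl = l].
have [eX _ eN] := partial_sizes pa.
apply: (runs_sweep (J := J) B_gt0 mnB n_gt0) => //.
- move=> k st1 st2 [sq' [a' [pa' lev' eL']]] Eh Er; exists sq', a'.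
  split=> //; last by rewrite Er.
  by apply: partial_ext pa' Eh _ => x /andP[hx _]; apply: Er.
- move=> {eX eN pa lev eL sq a}i j {}st hi hj cur [sq [a [pa lev eL]]].
  have [eK eI eJ eP [eX eN]] := cur.
  set k := i * n + j in eK *; set X := m * n in eX *.
  have kX : k < X by rewrite /k /X; nia.
  have curE : eval st current = heap st (4 * X + k).
    by rewrite /= eX eK; congr heap; lia.
  have tgtE : eval st target = heap st (5 * X + k) + 2 * c.
    by rewrite /= eX eK (partial_shift pa); congr (heap _ _ + _); lia.
  have aE := partial_current pa hi hj; have tE := partial_target pa hi hj.
  have flipE : run (flip_here up) st = State
      (upd (regs st) rOut (regs st rOut + 2))
      (upd (upd (upd (heap st) (4 * X + k)
        (if up then heap st (4 * X + k) + 2 else heap st (4 * X + k) - 2))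
        (regs st rOut) i) (regs st rOut + 1) j).
    rewrite /flip_here /= eX eK eI eJ.
    have -> : X + X + (X + X) + k = 4 * X + k by lia.
    have X4 : X + X + (X + X) + k = 4 * X + k by lia.
    by case: (up); rewrite /= ?eX ?eK X4.
  (* The truncated difference tests the side, and [absdiff] vanishes exactly at level [l]. *)
  have runE e1 e2 : run (If (if up then Sub e2 e1 else Sub e1 e2)
        (If (absdiff e1 (Reg rLvl)) Skip (flip_here up)) Skip) st =
      if (if up then eval st e1 < eval st e2 else eval st e2 < eval st e1) &&
         (eval st e1 == l) then run (flip_here up) st else st.
    have neqE x y : (x - y + (y - x) != 0) = (x != y) by clear; lia.
    rewrite -eL; move: (flip_here up) => P; case: (up);
      by rewrite /= -lt0n subn_gt0 neqE; case: ltnP => //= _; case: eqP.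
  rewrite runE {runE} curE tgtE.
  have -> : (if up then heap st (4 * X + k) < heap st (5 * X + k) + 2 * c
      else heap st (5 * X + k) + 2 * c < heap st (4 * X + k)) &&
      (heap st (4 * X + k) == l) =
      (0 < sign up * (a i j - t i j))%R && (a i j == Posz l).
    by move: aE tE; rewrite -/k -/X; case: (up) => /=; lia.
  (* A face left alone while on the wrong side is not at level [l], so its bound becomes strict. *)
  case: ifP => [/andP[wrong /eqP al]|stay]; last first.
    split=> //; exists sq, a; split=> //; case: lev => le lev.
    split=> // i' j' hi' hj' pos; have [le1 lt1] := lev _ _ hi' hj' pos; split=> //.
    rewrite ltnS leq_eqVlt => /predU1P[|/lt1 //] /eqP; rewrite cell_unique //.
    case/andP=> /eqP ei /eqP ej; rewrite ei ej in pos le1 *.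
    move: stay; rewrite pos /= => neq; rewrite lt_neqAle le1 andbT.
    by move: neq; case: (up); rewrite /= ?mulN1r ?mul1r ?eqr_opp => ->.
  rewrite flipE; set st1 := State _ _.
  have e1 : absz (sign up) = 1 by case: (up).
  pose F : face m n := (Ordinal hi, Ordinal hj).
  have [d dE] := partial_even pa hi hj.
  have ha := partial_heights pa.
  have ext : extremal m n a F.1 F.2 (sign up).
    apply: (extremal_above e1 ha ht hi hj (partial_even pa hi hj) wrong).
    by move=> i' j' hi' hj' /(lev.2 _ _ hi' hj')[]; rewrite al.
  have hb := heights_flip ha ext.
  set b := shift_at _ _ _ _ in hb.
  have bE i' j' : b i' j' = if (i' == i) && (j' == j)
      then (a i j - 2 * sign up)%R else a i' j' by [].
  have stepE : flips mu1 (rcons sq F) = flip F (flips mu1 sq).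
    by rewrite /flips foldl_rcons.
  split; first by split=> //=; rewrite /upd /=.
  exists (rcons sq F), b; split; last by rewrite /= /upd.
    have szE : size (rcons sq F) = (size sq).+1 by apply: size_rcons.
    split; rewrite /st1 /= ?szE; first 3 last.
    - apply: valid_flips_rcons (partial_valid pa) _.
      exact: heights_curl_free hb.
    - by rewrite stepE.
    - move=> i' j' hi' hj'; rewrite bE; case: ifP => [/andP[/eqP-> /eqP->]|_].
        by exists (d + sign up)%R; rewrite dE; lia.
      exact: (partial_even pa hi' hj').
    (* By parity the gap was at least 2, so the distance drops by exactly 2. *)
    - rewrite -(partial_dist pa); move: wrong; rewrite dE.
      have := dist_shift_at a t (- (2 * sign up))%R hi hj.
      by rewrite -/b dE; case: (up) => /=; lia.
    - move=> i' j' hi' hj'; rewrite bE (partial_out pa) -/X.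
      have lt : i' * n + j' < X by rewrite /X; nia.
      rewrite 2?upd_neq; try by apply/eqP; lia.
      rewrite /upd eqn_add2l cell_unique //; case: ifP => _; last first.
        exact: (partial_current pa hi' hj').
      move: wrong tE; rewrite dE -aE -/k -/X; case: (up) => /=; lia.
    - move=> i' j' hi' hj'; rewrite (partial_out pa) -/X.
      have lt : i' * n + j' < X by rewrite /X; nia.
      rewrite 3?upd_neq; try by apply/eqP; lia.
      exact: (partial_target pa hi' hj').
    - move=> q hq; rewrite (partial_out pa) -/X encode_flips_rcons.
      rewrite nth_cat size_encode_flips.
      have [lt|ge] := ltnP q (2 * size sq).
        by rewrite 3?upd_neq ?(partial_log pa lt) //; apply/eqP; lia.
      have [->|->] : q = 2 * size sq \/ q = 2 * size sq + 1 by lia.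
        by rewrite subnn /= upd_neq ?upd_eq //; apply/eqP; lia.
      by rewrite addKn /= addnA upd_eq.
    - by have [? ? ?] := partial_sizes pa.
    - exact: partial_shift pa.
    - by rewrite upd_eq (partial_out pa); lia.
  case: lev => le lev; split=> [u i' j' hi' hj'|i' j' hi' hj'].
    rewrite bE; case: ifP => [/andP[/eqP-> /eqP->]|_]; last exact: le.
    by move: wrong; rewrite u dE /=; lia.
  rewrite bE; case: ifP => [/andP[/eqP-> /eqP->]|ne] pos.
    by move: al; case: (up) => /=; lia.
  have [le1 lt1] := lev _ _ hi' hj' pos; split=> //.
  by rewrite ltnS leq_eqVlt cell_unique // ne /=.
- by exists sq, a.
Qed.

Hypothesis SB : 6 * (m + n) <= B.

(** After each sweep the wrong faces lie strictly below the current level. At level 0 none remain,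
    because memory holds the unshifted targets as naturals and so no target is negative. *)
Lemma runs_flip_down sq a st : partial sq a st ->
  (forall i j, i < m -> j < n -> (a i j <= Posz (4 * (m + n)))%R) ->
  runs B flip_down st (fun st' => exists sq' a', partial sq' a' st' /\
    (forall i j, i < m -> j < n -> (a' i j <= t i j)%R)).
Proof.
move=> pa low; have [_ eM eN] := partial_sizes pa.
pose J k st' := exists sq' a', [/\ partial sq' a' st',
  levelled false (4 * (m + n) - k) 0 a' & regs st' rLvl = 4 * (m + n) - k].
apply: (runs_seq B_gt0); apply: (runs_run B_gt0) => //.
apply: (@runs_weaken _ _ _ (J (4 * (m + n)))); last first.
  move=> st' [sq' [a' [pa' [_ lev] _]]]; exists sq', a'; split=> // i j hi hj.
  rewrite leNgt; apply/negP => wrong.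
  have := lev i j hi hj; rewrite /= !mul1r => -[|+ _]; first by lia.
  by have := partial_target pa' hi hj; lia.
apply: (runs_while B_gt0); first by lia.
- move=> k st' hk [sq' [a' [pa' lev eL]]]; split; first by rewrite /= eL; lia.
  apply: (runs_seq B_gt0); apply: runs_weaken (runs_flip_level pa' lev eL) _.
  move=> st1 [sq1 [a1 [pa1 [_ lev1] eL1]]]; apply: (runs_run B_gt0) => //.
  exists sq1, a1; split; last by rewrite /= /upd /= eL1; lia.
    apply: partial_ext pa1 _ _ => //= x /andP[_ hx].
    by rewrite upd_neq // neq_ltn hx.
  split=> // i j hi hj pos; have [_ /(_ ltac:(nia))] := lev1 i j hi hj pos.
  by rewrite /= !mul1r; lia.
- by move=> st' [sq' [a' [_ _ eL]]]; rewrite /= eL subnn.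
- exists sq, a; split.
  + by apply: partial_ext pa _ _ => //= x /andP[_ hx]; rewrite upd_neq // neq_ltn hx.
  + by split=> // i j hi hj _; have := low i j hi hj; rewrite /= subn0; lia.
  + by rewrite /= /upd /= eM eN subn0; lia.
Qed.

(** The mirror image of [runs_flip_down]. At the last level no face is below its target, and
    [levelled] has kept all faces from rising above theirs, so the heights have become [t]. *)
Lemma runs_flip_up sq a st : partial sq a st ->
  (forall i j, i < m -> j < n -> (a i j <= t i j)%R) ->
  (forall i j, i < m -> j < n -> (t i j <= Posz (6 * (m + n)))%R) ->
  runs B flip_up st (fun st' => exists sq', partial sq' t st').
Proof.
move=> pa low high; have [_ eM eN] := partial_sizes pa.
pose J k st' := exists sq' a',
  [/\ partial sq' a' st', levelled true k 0 a' & regs st' rLvl = k].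
apply: (runs_seq B_gt0); apply: (runs_run B_gt0) => //.
apply: (@runs_weaken _ _ _ (J (6 * (m + n)))); last first.
  move=> st' [sq' [a' [pa' [/(_ isT) le lev] _]]]; exists sq'.
  have at_t i j : i < m -> j < n -> a' i j = t i j.
    move=> hi hj; have := lev i j hi hj; rewrite /= !mulN1r.
    have := le i j hi hj; have := high i j hi hj.
    case: (ltrP 0 (- (a' i j - t i j))%R) => [_ ? ? /(_ isT)|] []; lia.
  case: pa' => sz sh out val hh ev di cur tg lo; split=> //.
  - exact: eq_heights at_t hh.
  - by move=> i j hi hj; exists 0%R; rewrite mulr0 addr0.
  - rewrite -di; congr addn; apply: eq_bigr => k _.
    by have /andP[hi hj] := cell_in k; rewrite at_t.
  - by move=> i j hi hj; rewrite -at_t // cur.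
apply: (runs_while B_gt0) => //.
- move=> k st' hk [sq' [a' [pa' lev eL]]]; have [_ eM' eN'] := partial_sizes pa'.
  split; first by rewrite /= eL eM' eN'; lia.
  apply: (runs_seq B_gt0); apply: runs_weaken (runs_flip_level pa' lev eL) _.
  move=> st1 [sq1 [a1 [pa1 [le1 lev1] eL1]]]; apply: (runs_run B_gt0) => //.
  exists sq1, a1; split; last by rewrite /= /upd /= eL1; lia.
    apply: partial_ext pa1 _ _ => //= x /andP[_ hx].
    by rewrite upd_neq // neq_ltn hx.
  split=> // i j hi hj pos; have [_ /(_ ltac:(nia))] := lev1 i j hi hj pos.
  by rewrite /= !mulN1r; lia.
- move=> st' [sq' [a' [pa' _ eL]]]; have [_ eM' eN'] := partial_sizes pa'.
  by rewrite /= eL eM' eN'; lia.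
- exists sq, a; split=> //.
  + by apply: partial_ext pa _ _ => //= x /andP[_ hx]; rewrite upd_neq // neq_ltn hx.
  + split=> // i j hi hj _; have := partial_current pa hi hj.
    by rewrite /= !mulN1r; lia.
Qed.
End FlipLevel.

(** * Layout of the input in memory *)

Lemma nth_allpairs (S T U : Type) (f : S -> T -> U) s t x0 y0 z0 i j :
  i < size s -> j < size t ->
  nth z0 [seq f x y | x <- s, y <- t] (i * size t + j) =
    f (nth x0 s i) (nth y0 t j).
Proof.
elim: s i => [|x s IH] [|i] //= hi hj; rewrite nth_cat size_map.
  by rewrite hj (nth_map y0).
by rewrite ifF ?mulSn; [rewrite -addnA addKn IH | lia].
Qed.

Section Encoding.
Variables (m n : nat).

Lemma size_encode_mv (mu : mv m n) :
  size (encode_mv mu) = m.-1 * n + m * n.-1.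
Proof. by rewrite size_cat !size_allpairs !size_enum_ord. Qed.

Lemma nth_encode_pbit (mu : mv m n) i j : i.+1 < m -> j < n ->
  nth 0 (encode_mv mu) (i * n + j) = pbit mu i j.
Proof.
rewrite -ltn_predRL => hi hj; rewrite nth_cat size_allpairs !size_enum_ord.
have -> : i * n + j < m.-1 * n by nia.
have := @nth_allpairs _ _ _ (fun i j => nat_of_bool (mu (inl (i, j))))
  (enum 'I_m.-1) (enum 'I_n) (Ordinal hi) (Ordinal hj) 0 i j.
rewrite !size_enum_ord => -> //.
by rewrite -pbitE !nth_enum_ord.
Qed.

Lemma nth_encode_zbit (mu : mv m n) i j : i < m -> j.+1 < n ->
  nth 0 (encode_mv mu) (m.-1 * n + (i * n.-1 + j)) = zbit mu i j.
Proof.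
rewrite -ltn_predRL => hi hj; rewrite nth_cat size_allpairs !size_enum_ord.
rewrite ltnNge leq_addr /= addKn.
have := @nth_allpairs _ _ _ (fun i j => nat_of_bool (mu (inr (i, j))))
  (enum 'I_m) (enum 'I_n.-1) (Ordinal hi) (Ordinal hj) 0 i j.
rewrite !size_enum_ord => -> //.
by rewrite -zbitE !nth_enum_ord.
Qed.

Lemma mv_at_encode (mu : mv m n) mem a :
  (forall q, q < size (encode_mv mu) -> mem (a + q) = nth 0 (encode_mv mu) q) ->
  mv_at mem a mu.
Proof.
rewrite size_encode_mv => memE.
have mE : m * n - n = m.-1 * n by case: (m) => // m'; rewrite mulSn addKn.
split=> i j hi hj.
  rewrite memE ?nth_encode_pbit //.
  by rewrite -ltn_predRL in hi; nia.
rewrite mE -addnA memE ?nth_encode_zbit // ltn_add2l.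
by rewrite -ltn_predRL in hj; nia.
Qed.

(** The second assignment starts after the two sizes and the first assignment, whose length is
    [(m - 1) * n + m * (n - 1)], that is [2 * m * n - (m + n)]. *)
Lemma mv_at_input (mu1 mu2 : mv m n) (mem := nth 0 (encode_input mu1 mu2)) :
  0 < m -> 0 < n -> mv_at mem 2 mu1 /\ mv_at mem (2 + (m * n + m * n - (m + n))) mu2.
Proof.
move=> m0 n0; split; apply: mv_at_encode => q hq; rewrite /mem /encode_input.
  by rewrite /= nth_cat hq.
have -> : m * n + m * n - (m + n) = size (encode_mv mu1).
  rewrite size_encode_mv; case: (m) m0 => // m' _; case: (n) n0 => // n' _ /=.
  by nia.
by rewrite -addnA /= nth_cat add0n ltnNge leq_addr /= addKn.
Qed.

End Encoding.

(** * Writing the output *)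

Definition copy_log : cmd :=
  Seq (Set_reg rK (Cst 0))
 (Seq (While (Sub (Reg rOut) (Add log_base (Reg rK)))
         (Seq (Store (Add (Reg rK) (Cst 1)) (Cell (Add log_base (Reg rK))))
              (Set_reg rK (Add (Reg rK) (Cst 1)))))
      (Store (Cst 0) (Sub (Reg rOut) log_base))).

(** Source and destination may overlap, but copying upwards is safe: round [k] writes address
    [k + 1], which is below the log cells still to be read since [X] is positive. *)
Lemma runs_copy_log B s st : 0 < B -> size s <= B -> 0 < regs st rX ->
  regs st rOut = 6 * regs st rX + size s ->
  (forall q, q < size s -> heap st (6 * regs st rX + q) = nth 0 s q) ->
  runs B copy_log st (fun st' => outputs st' s).
Proof.
move=> B_gt0 sB X0 eO memE; set X := regs st rX in X0 eO memE.
have X6 : X + X + (X + X) + X + X = 6 * X by lia.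
pose J k st' := [/\ regs st' rX = X, regs st' rOut = 6 * X + size s,
  regs st' rK = k,
  forall q, k <= q < size s -> heap st' (6 * X + q) = nth 0 s q &
  forall q, q < k -> heap st' q.+1 = nth 0 s q].
apply: (runs_seq B_gt0); apply: (runs_run B_gt0) => //.
apply: (runs_seq B_gt0); apply: (@runs_weaken _ _ _ (J (size s))); last first.
  move=> st' [eX eO' _ _ out]; apply: (runs_run B_gt0) => //.
  by split=> [|q hq]; rewrite /= /upd /= ?eX ?X6 ?eO' ?addKn ?out.
apply: (runs_while B_gt0) => //.
- move=> k st' hk [eX eO' eK src out]; split; first by rewrite /= eX eO' eK; lia.
  apply: (runs_run B_gt0) => //; rewrite /J /= eX eK X6 /upd /= addn1.
  split=> // q hq; case: eqP => E.
  + by lia.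
  + by apply: src; lia.
  + by case: E => ->; apply: src; rewrite leqnn.
  + by apply: out; lia.
- by move=> st' [eX eO' eK _ _]; rewrite /= eX eO' eK; lia.
Qed.

(** * The whole program and its correctness *)

Definition read_sizes : cmd :=
  Seq (Seq (Set_reg rM (Cell (Cst 0))) (Seq (Set_reg rN (Cell (Cst 1)))
        (Set_reg rK (Reg rM))))
      (While (Reg rK) (Seq (Set_reg rX (Add (Reg rX) (Reg rN)))
                           (Set_reg rK (Sub (Reg rK) (Cst 1))))).

Definition set_heights (sg : bool) (src dst off : expr) : cmd :=
  Seq (Seq (Set_reg rSrc src) (Seq (Set_reg rDst dst) (Set_reg rOff off)))
      (sweep (store_height sg)).

(* All heights and shifts used below are kept nonnegative by the offsets: heights
   are at most m + n in absolute value, hence differences at most 2 * (m + n). *)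
Definition compute_heights (sg : bool) : cmd :=
  Seq (set_heights sg (Cst 2) base1 (Add perimeter (Add perimeter perimeter)))
      (set_heights sg (Add (Cst 2) (Sub (Add (Reg rX) (Reg rX)) perimeter))
         base2 perimeter).

Definition shortest_flips (sg : bool) : cmd :=
  Seq read_sizes
 (Seq (compute_heights sg)
 (Seq best_shift
 (Seq (Set_reg rOut log_base)
 (Seq flip_down
 (Seq flip_up copy_log))))).

Section ShortestFlips.
Variables (B m n : nat).
Hypotheses (m_gt1 : 1 < m) (n_gt1 : 1 < n) (BE : B = 100 * (m * n) ^ 2).

Let B_gt0 : 0 < B. Proof. by rewrite BE muln_gt0 expn_gt0 muln_gt0; lia. Qed.
Let n_gt0 : 0 < n := ltnW n_gt1.
Let m_gt0 : 0 < m := ltnW m_gt1.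
Let mnB : m * n <= B. Proof. by rewrite BE; nia. Qed.
Let size_mn : m + n <= m * n. Proof. nia. Qed.

(** The product [m * n] is formed by [m] additions, as the machine cannot multiply. *)
Lemma runs_read_sizes (mu1 mu2 : mv m n) :
  runs B read_sizes (initial (encode_input mu1 mu2)) (fun st =>
    sizes m n (regs st) /\ heap st = nth 0 (encode_input mu1 mu2)).
Proof.
apply: (runs_seq B_gt0); apply: (runs_run B_gt0) => //.
pose J k st := [/\ heap st = nth 0 (encode_input mu1 mu2), regs st rM = m,
  regs st rN = n, regs st rX = k * n & regs st rK = m - k].
apply: (@runs_weaken _ _ _ (J m)); last by move=> st [-> ? ? ? _].
apply: (runs_while B_gt0).
- by move: mnB n_gt0; nia.
- move=> k st hk [Eh eM eN eX eK]; split; first by rewrite /= eK; lia.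
  by apply: (runs_run B_gt0) => //; split=> //; rewrite /= /upd /= ?eX ?eN ?eK ?mulSn; lia.
- by move=> st [_ _ _ _ eK]; rewrite /= eK subnn.
- by split; rewrite /= ?subn0.
Qed.

(** [dist] lists the faces in the order of their cells, so the sums agree term by term. *)
Lemma shift_costE mem H1 H2 c : heights_at m n mem (4 * (m * n)) H1 ->
  heights_at m n mem (5 * (m * n)) H2 ->
  shift_cost (m * n) mem c = dist m n H1 (fun i j => H2 i j + Posz (2 * c))%R.
Proof.
move=> at1 at2; apply: eq_bigr => q _; have /andP[hi hj] := cell_in q.
have := at1 _ _ hi hj; have := at2 _ _ hi hj; rewrite -divn_eq => <- <-.
by rewrite -PoszD.
Qed.

Lemma runs_compute_heights sg (mu1 mu2 : mv m n) st :
  curl_free sg mu1 -> curl_free sg mu2 -> sizes m n (regs st) ->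
  heap st = nth 0 (encode_input mu1 mu2) ->
  runs B (compute_heights sg) st (fun st' =>
    [/\ sizes m n (regs st'),
        heights_at m n (heap st') (4 * (m * n))
          (fun i j => height sg mu1 i j + Posz (3 * (m + n)))%R &
        heights_at m n (heap st') (5 * (m * n))
          (fun i j => height sg mu2 i j + Posz (m + n))%R]).
Proof.
move=> cf1 cf2 [eX eM eN] Eh; have [at1 at2] := mv_at_input mu1 mu2 m_gt0 n_gt0.
have X4 : m * n + m * n + (m * n + m * n) = 4 * (m * n) by lia.
have X5 : 4 * (m * n) + m * n = 5 * (m * n) by lia.
have S3 : m + n + (m + n + (m + n)) = 3 * (m + n) by lia.
have zE : m * n.-1 + m = m * n by rewrite -{2}(prednK n_gt0) mulnS addnC.
apply: (runs_seq B_gt0); apply: (runs_seq B_gt0); apply: (runs_run B_gt0) => //.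
rewrite /= /upd /= eX eM eN X4 S3; set st0 := State _ _.
have run0 := @runs_store_heights _ _ _ B_gt0 mnB m_gt0 n_gt0 sg mu1 st0.
apply: runs_weaken (run0 _ _ _ _ _ cf1) _.
- by [].
- by [].
- by rewrite /= /upd /=; lia.
- by rewrite /= /upd /=; lia.
- by rewrite /= /upd /= Eh.
move=> st1 [rs1 mem1 hs1]; rewrite /= /upd /= in rs1 mem1 hs1.
apply: (runs_seq B_gt0); apply: (runs_run B_gt0) => //.
rewrite /= /upd /= !rs1 //= eX eM eN X4 X5; set st2 := State _ _.
have run2 := @runs_store_heights _ _ _ B_gt0 mnB m_gt0 n_gt0 sg mu2 st2.
apply: runs_weaken (run2 _ _ _ _ _ cf2) _.
- by rewrite /= rs1.
- by rewrite /= rs1.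
- by [].
- by rewrite /=; lia.
- rewrite /=; split=> i j hi hj; rewrite mem1 ?Eh;
    try by [apply: at2.1 | apply: at2.2].
    have : i.+2 * n <= m * n by rewrite leq_mul2r hi orbT.
    by rewrite !mulSn => le; left; move: le hj; clear; lia.
  have : i.+1 * n.-1 <= m * n.-1 by rewrite leq_mul2r hi orbT.
  rewrite mulSn => le; left; move: zE le hj; rewrite -ltn_predRL.
  by move: (n.-1) (i * n.-1) (m * n.-1) m_gt1 n_gt1 size_mn; clear; lia.
move=> st3 [rs3 mem3 hs3]; split=> //.
  by split; rewrite rs3 // /= rs1.
move=> i j hi hj; rewrite mem3 /=; last by left; nia.
exact: hs1.
Qed.

(** The log has half the least cost tried as its length. Any other sequence ends at a height of
    [mu2] up to an even constant and is at least half as long as the distance to it; [dist_clamp]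
    provides a tried shift that is no worse. *)
Lemma runs_shortest_flips sg (mu1 mu2 : mv m n) :
  curl_free sg mu1 -> curl_free sg mu2 ->
  runs B (shortest_flips sg) (initial (encode_input mu1 mu2)) (fun st =>
    exists sq, [/\ outputs st (encode_flips sq), valid_flips sg mu1 sq,
      flips mu1 sq = mu2 & forall sq', valid_flips sg mu1 sq' ->
        flips mu1 sq' = mu2 -> size sq <= size sq']).
Proof.
move=> cf1 cf2; have hH1 := heights_height cf1; have hH2 := heights_height cf2.
have low1 i j : i < m -> j < n -> `|height sg mu1 i j| <= m + n.
  by move=> hi hj; have := heights_bound hH1 hi hj; rewrite height00; lia.
have low2 i j : i < m -> j < n -> `|height sg mu2 i j| <= m + n.
  by move=> hi hj; have := heights_bound hH2 hi hj; rewrite height00; lia.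
apply: (runs_seq B_gt0); apply: runs_weaken (runs_read_sizes mu1 mu2) _.
move=> st0 [sz0 Eh0].
apply: (runs_seq B_gt0).
apply: runs_weaken (runs_compute_heights cf1 cf2 sz0 Eh0) _ => st1 [sz1 at1 at2].
have SB : 6 * (m + n) <= B by rewrite BE; nia.
have SB2 : 2 * (m + n) < B by lia.
apply: (runs_seq B_gt0).
apply: runs_weaken (runs_best_shift B_gt0 mnB n_gt0 SB2 sz1) _ => st2.
set c := regs st2 rC => -[[eX eM eN] Eh2 cS best].
pose a0 i j : int := (height sg mu1 i j + Posz (3 * (m + n)))%R.
pose t i j : int := (height sg mu2 i j + Posz (m + n + 2 * c))%R.
have ha0 : heights sg mu1 a0 by apply: heights_addr.
have ht : heights sg mu2 t by apply: heights_addr.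
have distE c' : shift_cost (m * n) (heap st1) c' =
    dist m n a0 (fun i j => height sg mu2 i j + Posz (m + n + 2 * c'))%R.
  rewrite (shift_costE _ at1 at2); apply: eq_bigr => k _.
  by congr absz; rewrite /a0; lia.
apply: (runs_seq B_gt0); apply: (runs_run B_gt0) => //; set st3 := run _ _.
have pa0 : partial sg mu1 t c (dist m n a0 t) [::] a0 st3.
  split=> //.
  - by rewrite /= /upd /= eX muln0; lia.
  - move=> i j hi hj.
    have eq00 : height sg mu1 0 0 = height sg mu2 0 0 by rewrite !height00.
    have [d dE] := heights_even hH1 hH2 eq00 hi hj.
    (* The offsets [3 * (m + n)] and [m + n + 2 * c] differ by an even number, half of which enters
       the witness. *)
    by exists (d + Posz c - Posz (m + n))%R; rewrite /t /a0 dE; lia.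
  - by rewrite /= Eh2.
  - move=> i j hi hj; rewrite /= Eh2 at2 // /t; lia.
apply: (runs_seq B_gt0).
apply: runs_weaken (runs_flip_down B_gt0 mnB n_gt0 ht SB pa0 _) _.
  by move=> i j hi hj; have := low1 i j hi hj; rewrite /a0; lia.
move=> st4 [sq4 [a4 [pa4 le4]]]; apply: (runs_seq B_gt0).
apply: runs_weaken (runs_flip_up B_gt0 mnB n_gt0 ht SB pa4 le4 _) _.
  by move=> i j hi hj; have := low2 i j hi hj; rewrite /t; lia.
move=> st5 [sq pa]; have [eX5 _ _] := partial_sizes pa.
have size_sq : 2 * size sq = dist m n a0 t.
  by rewrite -(partial_dist pa) [dist m n t t]big1 ?addn0 // => k _; lia.
apply: runs_weaken (@runs_copy_log B (encode_flips sq) st5 B_gt0 _ _ _ _) _.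
- rewrite size_encode_flips size_sq.
  (* The encoded log has one word per unit of distance, and each face contributes at most
     [4 * (m + n)], well below [100 * (m * n)]. *)
  have -> : B = \sum_(k < m * n) (100 * (m * n)).
    by rewrite sum_nat_const card_ord BE; nia.
  apply: leq_sum => k _; have /andP[hi hj] := cell_in k.
  by have := low1 _ _ hi hj; have := low2 _ _ hi hj; rewrite /a0 /t; lia.
- by rewrite eX5; lia.
- by rewrite eX5 (partial_out pa) size_encode_flips.
- by rewrite eX5 size_encode_flips; apply: partial_log pa.
move=> st6 out; exists sq; split=> //; first exact: partial_valid pa.
  exact: heights_inj (partial_heights pa) ht.
move=> sq' val' eq'; have [H' []] := valid_flips_dist m_gt1 n_gt1 hH1 val'.
rewrite eq' => hH' le' [C eC]; rewrite height00 add0r in eC.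
have H'E i j : i < m -> j < n -> H' i j = (height sg mu2 i j + 2 * C)%R.
  by move=> hi hj; rewrite (heights_shift hH2 hH' hi hj) eC height00 subr0.
have close i j : i < m -> j < n ->
    `|(height sg mu1 i j - height sg mu2 i j)%R| <= 2 * (m + n).
  by move=> hi hj; have := low1 _ _ hi hj; have := low2 _ _ hi hj; lia.
have [c' c'S clamp] := dist_clamp C close.
rewrite -(leq_pmul2l (isT : 0 < 2)) size_sq -distE.
apply: leq_trans (best c' c'S) _; rewrite distE.
apply: leq_trans clamp _; apply: leq_trans le'.
by apply: leq_dist => i j hi hj; rewrite H'E.
Qed.

End ShortestFlips.

Theorem theorem4p3 (R : realFieldType) (w h s : R)
    (hw : (0 < w)%R) (hh : (0 < h)%R) (hs : (s != 0)%R) :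
  exists (P : cmd) (c k : nat),
  forall (m n : nat), 1 < m -> 1 < n ->
  forall mu1 mu2 : mv m n,
    locally_valid w h s mu1 -> locally_valid w h s mu2 ->
    exists (t : nat) (st : state) (sq : seq (face m n)),
      [/\ exec P (initial (encode_input mu1 mu2)) t st,
          t <= c * (m * n) ^ k,
          outputs st (encode_flips sq)
        & shortest_flip_sequence w h s mu1 mu2 sq].
Proof.
pose P := shortest_flips (0 < s)%R.
(* The loop bound [100 * (m * n) ^ 2], raised to the power [degree P], yields the constant and the
   exponent. *)
exists P, (coef P * 100 ^ degree P), (2 * degree P) => m n m1 n1 mu1 mu2.
rewrite !locally_validE // => cf1 cf2.
have [t [st [ex le [sq [out val end_sq best]]]]] :=
  runs_shortest_flips m1 n1 erefl cf1 cf2.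
exists t, st, sq; split=> //; first by rewrite -mulnA expnM -expnMn.
split=> [|sq' [val' end_sq']].
  by split=> // k hk; apply/(locally_validE _ _ hw hs)/val.
by apply: best => // k hk; apply/(locally_validE h _ hw hs)/val'.
Qed.
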